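(* Let $\mathbb{G}$ be a connected ribbon graph with edges $e_1,\dots,e_n$. There is a (bigraded, free abelian) cochain complex $\widetilde{A}(\mathbb{G})$ whose generators are in one-to-one correspondence with the spanning quasi-trees of $\mathbb{G}$ and whose homology is $\widetilde{Kh}(\mathbb{G})$. Moreover, the bigrading of (the generator corresponding to) each spanning quasi-tree $\mathbb{T}$ is $(i(\mathbb{T}),j(\mathbb{T}))$ where $$i(\mathbb{T})=2g(\mathbb{T})+ea(\mathbb{T})-ia(\mathbb{T})+|V(\mathbb{G})|-1,$$ $$j(\mathbb{T})=2\bigl(g(\mathbb{T})+ea(\mathbb{T})-ia(\mathbb{T})\bigr)+|V(\mathbb{G})|-1.$$
   Context: **Ribbon graphs.** A ribbon graph $\mathbb{G}$ (always oriented) is a finite nonempty graph (loops and multiple edges allowed) together with an embedding into a closed oriented surface $\Sigma$ whose complement is a disjoint union of open disks; equivalently, a graph with a cyclic order of the half-edges at each vertex. $V(\mathbb{G})$ is the vertex set; the genus $g(\mathbb{G})$ is the genus of $\Sigma$. $\Sigma_{\mathbb{G}}$ is a regular neighborhood of $\mathbb{G}$ in $\Sigma$: one disk per vertex, one band per edge. $F(\mathbb{G})$ is the set of boundary components of $\Sigma_{\mathbb{G}}$. A spanning ribbon subgraph $\mathbb{H}$ has the same vertices, a subset of the edges, and inherited cyclic orders; it has its own $\Sigma_{\mathbb{H}}$, $F(\mathbb{H})$ and genus $g(\mathbb{H})$ (the genus of $\Sigma_{\mathbb{H}}$ with its boundary capped by disks). A spanning quasi-tree is a spanning ribbon subgraph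 $\mathbb{T}$ such that $\Sigma_{\mathbb{T}}$ has exactly one boundary component. **Reduced Khovanov homology.** $(M[r]\{s\})^{i,j}=M^{i-r,j-s}$ ($i$ homological, $j$ polynomial grading). $V$ (without argument) is free abelian on $v_+,v_-$ in bigradings $(0,1),(0,-1)$. $m:V\otimes V\to V$: $v_+\otimes v_+\mapsto v_+$, $v_+\otimes v_-\mapsto v_-$, $v_-\otimes v_+\mapsto v_-$, $v_-\otimes v_-\mapsto 0$. $\Delta:V\to V\otimes V$: $v_+\mapsto v_+\otimes v_-+v_-\otimes v_+$, $v_-\mapsto v_-\otimes v_-$. For $I=(m_1,\dots,m_n)\in\{0,1\}^n$ let $h(I)=\sum m_i$, let $\mathbb{G}(I)$ be the spanning ribbon subgraph with edge set $\{e_i:m_i=1\}$, and $CKh(\mathbb{G})=\bigoplus_I V^{\otimes F(\mathbb{G}(I))}[h(I)]\{h(I)\}$. If $J$ is obtained from $I$ by changing the $k$th coordinate from $0$ to $1$ (a hypercube edge $\xi$), adding the band of $e_k$ merges two boundary components or splits one into two; $d_\xi$ is $m$ (merge) or $\Delta$ (split) on the affected factors and the identity on the others. $d=\sum_\xi(-1)^{|\{i<k:\,m_i=1\}|}d_\xi$ raises $i$ by 1 and preserves $j$. Fix a marked point on the boundary of a vertex disk of $\Sigma_{\mathbb{G}}$ away from all bands; $\widetilde{CKh}(\mathbb{G})$ is the subcomplex in which the factor of the boundary component containing the marked point is $\mathbb{Z}v_-$, with polynomial grading shifted up by $1$; $\widetilde{Kh}(\mathbb{G})$ is its bigraded homology.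 **Activities.** Order the edges by $e_i<e_j$ iff $i<j$. For a spanning quasi-tree $\mathbb{T}$, mark $2n$ points on the boundary circle of $\Sigma_{\mathbb{T}}$: for $e_i\in E(\mathbb{T})$, one point labeled $i$ on each of the two free sides of the band of $e_i$; for $e_i\notin E(\mathbb{T})$, one point labeled $i$ at each of the two places on the vertex-disk boundaries where the band of $e_i$ would be attached. The chord diagram $C(\mathbb{G},\mathbb{T})$ is the circle with these $2n$ points in the cyclic order along the boundary of $\Sigma_{\mathbb{T}}$, with a chord $c_i$ joining the two points labeled $i$. The edge $e_i$ is internal if $e_i\in E(\mathbb{T})$ and external otherwise; it is active if $c_i$ does not intersect any $c_j$ with $j<i$, and inactive otherwise. $ia(\mathbb{T})$ and $ea(\mathbb{T})$ are the numbers of internally active and externally active edges of $\mathbb{G}$ with respect to $\mathbb{T}$. *)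

(* Defs.v *)
From HB Require Import structures.
From mathcomp Require Import all_boot all_order all_fingroup all_algebra.
From mathcomp Require Import boolp.

Set Implicit Arguments.
Unset Strict Implicit.
Unset Printing Implicit Defensive.

Import GRing.Theory.

Local Open Scope ring_scope.

(* The free abelian group on a finite set of bihomogeneous generators, with an
   endomorphism given by its matrix: [dcoef x y] is the coefficient of the
   generator [y] in the image of the generator [x].  That the endomorphism has
   bidegree (1, 0) and square zero is not part of the data. *)
Record bigraded := Bigraded {
  gen : finType;
  hdeg : gen -> int;
  qdeg : gen -> int;
  dcoef : gen -> gen -> int
}.

Definition chain (C : bigraded) := {ffun gen C -> int}.

Definition differential (C : bigraded) (x : chain C) : chain C :=
  [ffun z => \sum_y x y * dcoef y z].

Definition homog (C : bigraded) (i j : int) : {pred chain C} :=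
  fun x => [forall y, (x y != 0) ==> (hdeg y == i) && (qdeg y == j)].
Arguments homog : clear implicits.

Definition is_cochain_complex (C : bigraded) : Prop :=
  (forall (i j : int) (x : chain C),
      x \in homog C i j -> differential x \in homog C (i + 1) j) /\
  (forall x : chain C, differential (differential x) = 0).

Definition cocycle (C : bigraded) (i j : int) : {pred chain C} :=
  fun x => (x \in homog C i j) && (differential x == 0).
Arguments cocycle : clear implicits.

Section Cohomology.
Variables (C : bigraded) (i j : int).

Lemma diffB (x y : chain C) :
  differential (x - y) = differential x - differential y.
Proof.
apply/ffunP => z; rewrite !ffunE -sumrB.
by apply: eq_bigr => w _; rewrite !ffunE mulrBl.
Qed.

Lemma diff0 : differential (0 : chain C) = 0.
Proof. by have := diffB 0 0; rewrite !subrr. Qed.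

Lemma homog_zmod_closed (k l : int) : zmod_closed (homog C k l).
Proof.
split=> [|x y /forallP xh /forallP yh]; apply/forallP => z;
  rewrite !ffunE ?eqxx //.
apply/implyP; move: (xh z) (yh z).
have [->|//] := eqVneq (x z) 0; have [->|//] := eqVneq (y z) 0.
by rewrite subrr eqxx.
Qed.

Lemma cocycle_zmod_closed : zmod_closed (cocycle C i j).
Proof.
have [h0 hB] := homog_zmod_closed i j.
split=> [|x y /andP[xh /eqP xd] /andP[yh /eqP yd]].
  by rewrite unfold_in h0 diff0 eqxx.
by rewrite unfold_in hB // diffB xd yd subrr eqxx.
Qed.

HB.instance Definition _ :=
  GRing.isZmodClosed.Build (chain C) (cocycle C i j) cocycle_zmod_closed.

Record cocycles :=
  Cocycle { cochain :> chain C; _ : cochain \in cocycle C i j }.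

HB.instance Definition _ := [isSub for cochain].
HB.instance Definition _ := [Choice of cocycles by <:].
HB.instance Definition _ := [SubChoice_isSubZmodule of cocycles by <:].

Definition coboundary : {pred cocycles} := fun z =>
  `[< exists2 y : chain C,
        y \in homog C (i - 1) j & differential y = cochain z >].

Lemma coboundary_zmod_closed : zmod_closed coboundary.
Proof.
have [h0 hB] := homog_zmod_closed (i - 1) j.
split=> [|x y /asboolP[x' xh xd] /asboolP[y' yh yd]]; apply/asboolP.
  by exists 0; rewrite ?diff0.
by exists (x' - y'); rewrite ?hB // diffB xd yd.
Qed.

HB.instance Definition _ :=
  GRing.isZmodClosed.Build cocycles coboundary coboundary_zmod_closed.

Definition cohomology : zmodType := Quotient.quot coboundary.

End Cohomology.

Definition isomorphic (U V : zmodType) : Prop :=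
  exists f : {additive U -> V}, bijective f.

(* The two ends of the edge [i] are the half-edges [(i, false)], [(i, true)]. *)
Definition half_edge (n : nat) : finType := ('I_n * bool)%type.

Definition opp_half {n : nat} (h : half_edge n) : half_edge n := (h.1, ~~ h.2).

(* [rotation h] is the half-edge that follows [h] counterclockwise at its vertex:
   the cycles of [rotation] are the cyclically ordered sets of half-edges at the
   vertices of nonzero degree. *)
Record ribbon_graph (n : nat) := RibbonGraph {
  vertex : finType;
  vertex_gt0 : (0 < #|vertex|)%N;
  base : half_edge n -> vertex;
  rotation : {perm half_edge n};
  rot_star : forall h k, (k \in porbit rotation h) = (base h == base k)
}.

Section Ribbon.
Variables (n : nat) (G : ribbon_graph n).
Implicit Type S : {set 'I_n}.

(* A spanning ribbon subgraph is given by its edge set. *)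
Definition adjacent S : rel (vertex G) := fun v w =>
  [exists h : half_edge n,
    [&& h.1 \in S, base G h == v & base G (opp_half h) == w]].

Definition connected_graph : Prop :=
  forall v w : vertex G, connect (adjacent setT) v w.

(* The attaching places of the bands of all the edges cut the boundaries of the
   vertex disks into arcs: [inl h] is the arc that ends, counterclockwise, at the
   place of [h]; an isolated vertex has a single arc, its whole boundary. *)
Definition isolated : pred (vertex G) := fun v => [forall h, base G h != v].
Definition disk_arc : finType := (half_edge n + {v | isolated v})%type.

(* The oriented boundary of the surface of [S] goes from the arc [inl h] to the
   next one past the place of [h]: if the edge of [h] is not in [S], it stays on
   the same vertex disk; otherwise it runs along a free side of the band, to the
   far end of the place of the opposite half-edge. *)
Definition next_half S (h : half_edge n) : half_edge n :=
  rotation G (if h.1 \in S then opp_half h else h).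

Definition next_arc S (a : disk_arc) : disk_arc :=
  match a with inl h => inl (next_half S h) | inr v => inr v end.

Lemma next_half_inj S : injective (next_half S).
Proof.
have tK : involutive (fun h => if h.1 \in S then opp_half h else h).
  move=> [i b] /=; have [iS|iNS] := boolP (i \in S);
    last by rewrite (negPf iNS).
  by rewrite /= iS /opp_half /= negbK.
by move=> h k /perm_inj /(inv_inj tK).
Qed.

Lemma next_arc_inj S : injective (next_arc S).
Proof. by move=> [h|v] [k|w] //= [] // /next_half_inj ->. Qed.

Definition bdry_perm S : {perm disk_arc} := perm (@next_arc_inj S).

(* The set of boundary components; each is identified with its set of arcs. *)
Definition bdry S : finType :=
  {c : {set disk_arc} | c \in porbits (bdry_perm S)}.

Definition bdry_at S (a : disk_arc) : bdry S :=
  exist _ (porbit (bdry_perm S) a) (imset_f _ (erefl true)).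

(* Euler's formula for the capped surface:
   |V| - |S| + |F(S)| = 2 k(S) - 2 g(S), with k(S) the number of components. *)
Definition genus S : nat :=
  ((2 * n_comp (adjacent S) predT + #|S|) - (#|vertex G| + #|bdry S|))./2.

Definition is_quasi_tree S : bool := #|bdry S| == 1%N.
Definition quasi_tree : finType := {T : {set 'I_n} | is_quasi_tree T}.

(* Along the boundary of the surface of a quasi-tree [T], the points of the chord
   diagram are the places or free sides that [next_half T] goes past; the point
   met at the end of the arc [inl h] is named [h], so that the chord of the edge
   [i] joins [(i, false)] to [(i, true)].  The chords of [i] and [j] intersect
   when exactly one end of the latter lies on the oriented circle arc from
   [(i, false)] to [(i, true)]. *)
Definition chords_cross (T : {set 'I_n}) (i j : 'I_n) : bool :=
  let pos h := findex (next_half T) (i, false) h in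
  (pos (j, false) < pos (i, true))%N (+) (pos (j, true) < pos (i, true))%N.

Definition active (T : {set 'I_n}) (i : 'I_n) : bool :=
  [forall j : 'I_n, (j < i)%N ==> ~~ chords_cross T i j].

Definition int_act (T : {set 'I_n}) : nat :=
  #|[set i | (i \in T) && active T i]|.
Definition ext_act (T : {set 'I_n}) : nat :=
  #|[set i | (i \notin T) && active T i]|.

Definition qt_hdeg (T : quasi_tree) : int :=
  2 * (genus (val T))%:Z + (ext_act (val T))%:Z - (int_act (val T))%:Z
  + #|vertex G|%:Z - 1.

Definition qt_qdeg (T : quasi_tree) : int :=
  2 * ((genus (val T))%:Z + (ext_act (val T))%:Z - (int_act (val T))%:Z)
  + #|vertex G|%:Z - 1.

(* The basis vectors v_+ and v_- of V are encoded by [true] and [false]. *)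
Definition vdeg (a : bool) : int := if a then 1 else -1.

(* The coefficient of v_c in m(v_a (x) v_b). *)
Definition m_coef (a b c : bool) : int :=
  match a, b, c with
  | true, true, true | true, false, false | false, true, false => 1
  | _, _, _ => 0
  end.

(* The coefficient of v_b (x) v_c in Delta(v_a). *)
Definition Delta_coef (a b c : bool) : int :=
  match a, b, c with
  | true, true, false | true, false, true | false, false, false => 1
  | _, _, _ => 0
  end.

(* A vertex of the hypercube and a basis vector of V^{(x) F} at that vertex. *)
Definition kh_gen : finType := {S : {set 'I_n} & {ffun bdry S -> bool}}.

Definition label (x : kh_gen) (a : disk_arc) : bool :=
  tagged x (bdry_at (tag x) a).

(* The matrix entry of d_xi from [x] to [y], for the hypercube edge xi that adds
   the edge [e].  The affected components, before and after, are those of the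
   arcs [p] and [q] that end at the two places of [e]; the other ones are the
   same sets of arcs before and after. *)
Definition dxi_coef (e : 'I_n) (x y : kh_gen) : int :=
  let p : disk_arc := inl (e, false) in
  let q : disk_arc := inl (e, true) in
  let at_ a := bdry_at (tag x) a in
  if [forall a : disk_arc,
        (at_ a != at_ p) && (at_ a != at_ q) ==> (label x a == label y a)]
  then if at_ p != at_ q
       then m_coef (label x p) (label x q) (label y p)
       else Delta_coef (label x p) (label y p) (label y q)
  else 0.

Definition kh_coef (x y : kh_gen) : int :=
  \sum_(e | (e \notin tag x) && (tag y == e |: tag x))
     (-1) ^+ #|[set i in tag x | (i < e)%N]| * dxi_coef e x y.

Definition kh_hdeg (x : kh_gen) : int := #|tag x|%:Z.
Definition kh_qdeg (x : kh_gen) : int :=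
  #|tag x|%:Z + \sum_(c : bdry (tag x)) vdeg (tagged x c).

Definition CKh : bigraded := Bigraded kh_hdeg kh_qdeg kh_coef.

(* The subcomplex for a marked point on the arc [p]: v_- on its component. *)
Definition rkh_gen (p : disk_arc) : finType := {x : kh_gen | ~~ label x p}.

Definition rCKh (p : disk_arc) : bigraded :=
  @Bigraded (rkh_gen p) (fun x => kh_hdeg (val x)) (fun x => kh_qdeg (val x) + 1)
    (fun x y => kh_coef (val x) (val y)).

Definition rKh (p : disk_arc) (i j : int) : zmodType :=
  cohomology (rCKh p) i j.

End Ribbon.

(* Main.v *)
From HB Require Import structures.
Require Import Defs.
From mathcomp Require Import all_boot all_order all_fingroup all_algebra.
From mathcomp Require Import boolp ring zify.

(** The reduced complex is shrunk by Gaussian elimination to one generator for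
    each quasi-tree. If its generators split as X, Y and Z so that the block
    of the differential from X to Y is invertible over the integers, it is
    homotopy equivalent to a complex on Z ([collapsible_reduction]). A set of
    generators with such a splitting is called collapsible to Z, and the
    splittings of two sets can be united if the differential goes only one way
    between them ([collapsible_glue]).

    The vertices of the cube are grouped according to quasi-trees. Fix a
    quasi-tree T and let its cell consist of the edge sets that agree with T
    on the inactive edges. Now release the inactive edges one by one, in
    increasing order. When [i] is released, some lower edge [j] has a chord
    that crosses the chord of [i], toggling [i] and [j] in T gives a
    quasi-tree T' with the same active edges above [i], and the enlarged cell
    of T is the disjoint union of the former cells of T and T', which differ
    at [i] ([in_cell_split]). The differential adds edges, hence goes only one
    way between the two, and they can be glued. When all edges have been
    released, the cell of any quasi-tree is the whole cube; a quasi-tree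
    exists because the graph is connected ([exists_quasi_tree]).

    It remains to collapse the cell of T to one generator. The chords of the
    active edges do not cross. Take one that is innermost as seen from the
    marked point: it cuts off a far circle that no other edge of the cell
    touches. The multiplication by v_+ on the far side, and the component of
    Delta with v_- on the far side, are both the identity on the other factor,
    which cancels all generators but those where the edge differs from T and
    the far circle has label v_+ for an external edge, v_- for an internal one
    ([collapsible_peel]). These form the same problem with one chord fewer.
    The last survivor differs from T at all active edges, and each of them has
    shifted the bidegree by (1, 2) or (-1, -2) ([collapsible_disk]). As T
    alone, with its circle labelled v_-, has bidegree (|T|, |T|), and |T| =
    |V| - 1 + 2 g(T) by Euler's formula ([quasi_tree_genus]), the result is
    the bidegree claimed.

    That the cube is a complex is seen by writing the tensor power of V over
    the boundary components as a quotient of a polynomial ring with one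
    variable for each arc, where v_+ is 1 and v_- is the variable: the merge
    is a quotient map and the split is the multiplication by the sum of two
    variables ([edge_map_mono]). So the faces of the cube need to be compared
    on 1 only ([edge_mapC]). *)

Set Implicit Arguments.
Unset Strict Implicit.
Unset Printing Implicit Defensive.

Import GRing.Theory.

Local Open Scope ring_scope.

(** * Cancelling pairs of generators in a cochain complex *)

Section Chains.
Variable C : bigraded.
Implicit Types (c : chain C) (U X Y Z : {set gen C}).

HB.instance Definition _ :=
  GRing.isZmodMorphism.Build (chain C) (chain C) (@differential C) (@diffB C).

HB.instance Definition _ i j :=
  GRing.isZmodClosed.Build (chain C) (homog C i j) (homog_zmod_closed C i j).

Lemma homogP i j c :
  reflect (forall y, c y != 0 -> hdeg y = i /\ qdeg y = j) (c \in homog C i j).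
Proof.
apply: (iffP forallP) => [ch y cy | ch y].
  by have /implyP/(_ cy)/andP[/eqP-> /eqP->] := ch y.
by apply/implyP => /ch[-> ->]; rewrite !eqxx.
Qed.

Definition basis (x : gen C) : chain C := [ffun y => (x == y)%:R].

Definition restr X c : chain C := [ffun y => if y \in X then c y else 0].

Lemma restr_zmod_morphism X : zmod_morphism (restr X).
Proof.
by move=> c c'; apply/ffunP => y; rewrite !ffunE; case: ifP; rewrite ?subrr.
Qed.

HB.instance Definition _ X :=
  GRing.isZmodMorphism.Build (chain C) (chain C) (restr X)
    (restr_zmod_morphism X).

Lemma restr_restr X Y c : restr X (restr Y c) = restr (X :&: Y) c.
Proof. by apply/ffunP => y; rewrite !ffunE inE; case: (y \in X). Qed.

Lemma restr_disjoint X Y c : [disjoint X & Y] -> restr X (restr Y c) = 0.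
Proof.
rewrite restr_restr -setI_eq0 => /eqP->.
by apply/ffunP => y; rewrite !ffunE inE.
Qed.

Lemma restrU X Y c :
  [disjoint X & Y] -> restr (X :|: Y) c = restr X c + restr Y c.
Proof.
move=> XY; apply/ffunP => y; rewrite !ffunE inE.
by case: (boolP (y \in X)) => [/(disjointFr XY)->|_]; rewrite ?addr0 ?add0r.
Qed.

Lemma restrT c : restr setT c = c.
Proof. by apply/ffunP => y; rewrite ffunE inE. Qed.

Lemma restr_d_restr0 X Y c :
  (forall x y, x \in X -> y \in Y -> dcoef x y = 0) ->
  restr Y (differential (restr X c)) = 0.
Proof.
move=> d0; apply/ffunP => y; rewrite !ffunE; case: ifP => // yY.
apply: big1 => x _; rewrite ffunE.
by case: ifP => xX; rewrite ?mul0r // d0 ?mulr0.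
Qed.

Lemma dcoef_deg (x y : gen C) : is_cochain_complex C -> dcoef x y != 0 ->
  hdeg y = hdeg x + 1 /\ qdeg y = qdeg x.
Proof.
move=> [dh _] dxy.
have /(dh _ _ _)/homogP : basis x \in homog C (hdeg x) (qdeg x).
  apply/homogP => z; rewrite ffunE.
  by case: (eqVneq x z) => [<-|]; rewrite ?eqxx.
apply; rewrite ffunE (bigD1 x) //= ffunE eqxx mul1r big1 ?addr0 // => z zx.
by rewrite ffunE eq_sym (negPf zx) mul0r.
Qed.

(** [h] is the inverse of the block of the differential from [X] to [Y],
    extended by zero to all chains. *)
Definition inverts X Y (h : chain C -> chain C) : Prop :=
  [/\ forall c, restr X (h c) = h c, forall c, h (restr Y c) = h c,
      forall c, h (differential (restr X c)) = restr X c &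
      forall c, restr Y (differential (h c)) = restr Y c].

(** Gaussian elimination: the generators of [U] outside [Z] come in two groups
    [X] and [Y] between which the differential is invertible over the
    integers. All of them are cancelled in one step, so invertibility of this
    block takes the place of the acyclicity of a matching. *)
Definition collapsible U Z : Prop :=
  exists X Y (h : {additive chain C -> chain C}),
    [/\ U = X :|: Y :|: Z,
        [/\ [disjoint X & Y], [disjoint X & Z] & [disjoint Y & Z]],
        (forall i j c, c \in homog C (i + 1) j -> h c \in homog C i j) &
        inverts X Y h].

Lemma collapsible_id Z : collapsible Z Z.
Proof.
exists set0, set0, \0; split=> //.
- by rewrite !set0U.
- by rewrite -!setI_eq0 !set0I eqxx.
- by move=> i j c _; apply/homogP => y; rewrite ffunE eqxx.
- have r0 c : restr set0 c = 0 by apply/ffunP => y; rewrite !ffunE inE.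
  by split=> c //=; rewrite !r0.
Qed.

(** When the differential never goes from [U2] to [U1], its block from [X1 :|:
    X2] to [Y1 :|: Y2] is triangular, with inverse [h1 + h2 - h2 d h1]. *)
Lemma collapsible_glue U1 U2 Z1 Z2 : is_cochain_complex C ->
  [disjoint U1 & U2] -> (forall x y, x \in U2 -> y \in U1 -> dcoef x y = 0) ->
  collapsible U1 Z1 -> collapsible U2 Z2 -> collapsible (U1 :|: U2) (Z1 :|: Z2).
Proof.
move=> [dh _] U12 d0 [X1 [Y1 [h1 [eU1 [XY1 XZ1 YZ1] hh1 [Xh1 hY1 hdX1 Ydh1]]]]].
move=> [X2 [Y2 [h2 [eU2 [XY2 XZ2 YZ2] hh2 [Xh2 hY2 hdX2 Ydh2]]]]].
have dis (A B : {set gen C}) : A \subset U1 -> B \subset U2 -> [disjoint A & B].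
  by move=> A1 B2; apply: disjointWl A1 (disjointWr B2 U12).
have sid (A B : {set gen C}) : A \subset U2 -> B \subset U1 -> [disjoint A & B].
  by move=> A2 B1; rewrite disjoint_sym dis.
have [sX1 sY1 sZ1] : [/\ X1 \subset U1, Y1 \subset U1 & Z1 \subset U1].
  by rewrite eU1 -setUA subsetUl setUCA subsetUl setUA subsetUr.
have [sX2 sY2 sZ2] : [/\ X2 \subset U2, Y2 \subset U2 & Z2 \subset U2].
  by rewrite eU2 -setUA subsetUl setUCA subsetUl setUA subsetUr.
have h1X2 c : h1 (differential (restr X2 c)) = 0.
  rewrite -hY1 restr_d_restr0 ?raddf0 // => x y xX yY.
  by rewrite d0 ?(subsetP sX2) ?(subsetP sY1).
have Y1h2 c : restr Y1 (differential (h2 c)) = 0.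
  rewrite -Xh2 restr_d_restr0 // => x y xX yY.
  by rewrite d0 ?(subsetP sX2) ?(subsetP sY1).
have h1Y2 c : h1 (restr Y2 c) = 0.
  by rewrite -hY1 restr_disjoint ?dis ?raddf0.
have h2Y1 c : h2 (restr Y1 c) = 0.
  by rewrite -hY2 restr_disjoint ?raddf0 // disjoint_sym dis.
have XX : [disjoint X1 & X2] by apply: dis.
have XX' : [disjoint X2 & X1] by apply: sid.
have YY : [disjoint Y1 & Y2] by apply: dis.
exists (X1 :|: X2), (Y1 :|: Y2).
exists (h1 \+ (h2 \- (h2 \o @differential C \o h1))); split.
- by rewrite eU1 eU2 -!setUA; congr (_ :|: _); rewrite setUC -!setUA;
    apply/setP => x; rewrite !inE; do !case: (x \in _).
- rewrite -!setI_eq0 !setIUl !setIUr !setU_eq0 !setI_eq0.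
  rewrite XY1 XY2 XZ1 XZ2 YZ1 YZ2 ?(dis _ _ sX1) ?(sid _ _ sX2) //.
  by rewrite ?(dis _ _ sY1) ?(sid _ _ sY2).
- move=> i j c ch; have h1c := hh1 _ _ _ ch; have h2c := hh2 _ _ _ ch.
  have h3c := hh2 _ _ _ (dh _ _ _ h1c).
  by rewrite /= rpredD ?rpredB.
- split=> c /=.
  + rewrite restrU // !raddfD !raddfN /= !Xh1 !Xh2.
    rewrite -[in restr X1 (h2 c)]Xh2 -[in restr X1 (h2 (differential _))]Xh2.
    rewrite -[in restr X2 (h1 c)]Xh1 !(restr_disjoint _ XX).
    by rewrite (restr_disjoint _ XX') subr0 addr0 add0r.
  + by rewrite !restrU // !raddfD /= hY1 h1Y2 h2Y1 hY2 !raddf0 !addr0 add0r.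
  + rewrite restrU // !raddfD /= !hdX1 !h1X2 !hdX2 !addr0.
    by rewrite !raddf0 addr0 [X in _ + X]addrAC subrr add0r.
  + rewrite !restrU // !raddfD !raddfN /= !Ydh1 !Y1h2 !Ydh2 oppr0 !addr0.
    by rewrite ?addr0 [X in _ + X]addrCA subrr addr0.
Qed.


(** The basic cancellation: [r] is the graph of a bijection from [X] to [Y],
    and the block of the differential is its permutation matrix up to signs.
    *)
Lemma collapsible_pair X Y (r : rel (gen C)) (eps : gen C -> int) :
  is_cochain_complex C -> [disjoint X & Y] ->
  (forall x, eps x * eps x = 1) ->
  {in X & Y, forall x y, dcoef x y = if r x y then eps x else 0} ->
  {in X, forall x, exists2 y, y \in Y & r x y} ->
  {in Y, forall y, exists2 x, x \in X & r x y} ->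
  {in X & Y &, forall x y y', r x y -> r x y' -> y = y'} ->
  {in X & X & Y, forall x x' y, r x y -> r x' y -> x = x'} ->
  collapsible (X :|: Y) set0.
Proof.
move=> Cc XY eps1 dr rX rY rfun rinj.
pose h (c : chain C) : chain C :=
  [ffun x => if x \in X then eps x * \sum_(y in Y | r x y) c y else 0].
have h_add : zmod_morphism h.
  move=> c c'; apply/ffunP => x; rewrite !ffunE; case: ifP; rewrite ?subrr //.
  move=> _; rewrite -mulrBr -sumrB; congr (_ * _).
  by apply: eq_bigr => y _; rewrite !ffunE.
pose H : {additive chain C -> chain C} :=
  HB.pack h (GRing.isZmodMorphism.Build _ _ h h_add).
have hE c x y : x \in X -> y \in Y -> r x y -> h c x = eps x * c y.
  move=> xX yY rxy; rewrite ffunE xX (big_pred1 y) // => y' /=.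
  apply/andP/eqP => [[y'Y rxy']|->//].
  exact: (rfun x y' y).
exists X, Y, H; rewrite setU0; split=> //.
- by split=> //; rewrite -setI_eq0 setI0.
- move=> i j c /homogP ch; apply/homogP => x hx /=.
  have xX : x \in X by move: hx; rewrite ffunE; case: ifP; rewrite ?eqxx.
  have [y yY rxy] := rX x xX; move: hx; rewrite /= (hE c x y) //.
  rewrite mulf_eq0 negb_or => /andP[ex /ch[]].
  have /(dcoef_deg Cc)[-> ->] : dcoef x y != 0 by rewrite dr // rxy.
  by move=> /addIr.
- split=> c /=; apply/ffunP => x; rewrite !ffunE; case: ifP => // xX.
  + by rewrite xX.
  + by congr (_ * _); apply: eq_bigr => y /andP[yY _]; rewrite ffunE yY.
  + have [y yY rxy] := rX x xX; rewrite (big_pred1 y) => [|y'] /=; last first.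
      by apply/andP/eqP => [[y'Y rxy']|->//]; apply: (rfun x y' y).
    rewrite ffunE (bigD1 x) //= ffunE xX dr // rxy big1 ?addr0 => [|x' x'x].
      by rewrite mulrCA eps1 mulr1.
    rewrite ffunE; case: ifP => x'X; rewrite ?mul0r // dr //.
    case: ifP => rx'y; rewrite ?mulr0 //.
    by rewrite (rinj x' x y) ?eqxx in x'x.
  + have [x' x'X rx'x] := rY x xX.
    rewrite (bigD1 x') //= (hE c x' x) // dr // rx'x mulrAC eps1 mul1r.
    rewrite big1 ?addr0 // => w wx'.
    have [wX|wX] := boolP (w \in X); last first.
      by rewrite ffunE (negPf wX) mul0r.
    rewrite dr //; case: ifP => rwx; rewrite ?mulr0 //.
    by rewrite (rinj w x' x) ?eqxx in wx'.
Qed.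

End Chains.

(** * Chain maps and cohomology *)

Section InducedMap.
Variables (A B : bigraded) (f : {additive chain A -> chain B}).
Hypothesis f_homog : forall i j c, c \in homog A i j -> f c \in homog B i j.
Hypothesis f_diff : forall c, differential (f c) = f (differential c).
Variables i j : int.

Lemma map_cocycle (z : cocycles A i j) : f (cochain z) \in cocycle B i j.
Proof.
have /andP[zh /eqP zd] := valP z.
by rewrite unfold_in f_homog // f_diff zd raddf0 eqxx.
Qed.

Definition on_cocycles (z : cocycles A i j) : cocycles B i j :=
  Cocycle (map_cocycle z).

Definition on_cohomology (x : cohomology A i j) : cohomology B i j :=
  \pi_(cohomology B i j)%qT (on_cocycles (generic_quotient.repr x)).

Lemma on_cocyclesB z z' : on_cocycles (z - z') = on_cocycles z - on_cocycles z'.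
Proof. by apply: val_inj; rewrite /= raddfB. Qed.

Lemma on_cocycles_coboundary z :
  z \in coboundary (C:=A) (i:=i) (j:=j) ->
  on_cocycles z \in coboundary (C:=B) (i:=i) (j:=j).
Proof.
move=> /asboolP[y yh yd]; apply/asboolP; exists (f y); first exact: f_homog.
by rewrite f_diff yd.
Qed.

Lemma cohomology_eq C (z z' : cocycles C i j) :
  (z - z' \in coboundary (C:=C) (i:=i) (j:=j)) =
  (\pi_(cohomology C i j) z == \pi_(cohomology C i j) z')%qT.
Proof. exact: Quotient.idealrBE. Qed.

Lemma on_cohomology_pi z :
  on_cohomology (\pi_(cohomology A i j) z)%qT =
  (\pi_(cohomology B i j) (on_cocycles z))%qT.
Proof.
apply/eqP; rewrite -cohomology_eq -on_cocyclesB on_cocycles_coboundary //.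
by rewrite cohomology_eq reprK.
Qed.

Lemma on_cohomology_zmod_morphism : zmod_morphism on_cohomology.
Proof.
elim/quotW=> x; elim/quotW=> y.
by rewrite -raddfB !on_cohomology_pi on_cocyclesB raddfB.
Qed.

HB.instance Definition _ :=
  GRing.isZmodMorphism.Build _ _ on_cohomology on_cohomology_zmod_morphism.

End InducedMap.

Lemma homotopy_equiv_isomorphic (A B : bigraded)
    (f : {additive chain A -> chain B}) (g : {additive chain B -> chain A})
    (h : {additive chain B -> chain B}) :
  (forall i j c, c \in homog A i j -> f c \in homog B i j) ->
  (forall i j c, c \in homog B i j -> g c \in homog A i j) ->
  (forall i j c, c \in homog B (i + 1) j -> h c \in homog B i j) ->
  (forall c, differential (f c) = f (differential c)) ->
  (forall c, differential (g c) = g (differential c)) ->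
  cancel f g ->
  (forall c, f (g c) = c - h (differential c) - differential (h c)) ->
  forall i j, isomorphic (cohomology A i j) (cohomology B i j).
Proof.
move=> fh gh hh fd gd fK gf i j; exists (on_cohomology fh fd (i := i) (j := j)).
exists (on_cohomology gh gd (i := i) (j := j)).
  elim/quotW=> z; rewrite /= (on_cohomology_pi fh) (on_cohomology_pi gh).
  congr (\pi_(_) _)%qT.
  by apply: val_inj; rewrite /= fK.
elim/quotW=> z; rewrite /= (on_cohomology_pi gh) (on_cohomology_pi fh).
apply/eqP.
rewrite eq_sym -cohomology_eq; apply/asboolP.
have /andP[zh /eqP zd] := valP z; exists (h (cochain z)).
  by apply: hh; rewrite subrK.
rewrite /= gf zd raddf0 subr0.
by rewrite subKr.
Qed.

(** The differential of the reduced complex is the zigzag formula [d - d h d]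
    between surviving generators. Up to the inclusion [Inc] and the projection
    [Pro] of the span of the survivors, [1 - h d] and [1 - d h] are mutually
    inverse homotopy equivalences, with [h] as the homotopy. *)
Lemma collapsible_reduction (C : bigraded) (I : finType) (z : I -> gen C)
    (hd qd : I -> int) :
  is_cochain_complex C -> injective z ->
  (forall a, hdeg (z a) = hd a /\ qdeg (z a) = qd a) ->
  collapsible [set: gen C] [set z a | a : I] ->
  exists coef : I -> I -> int, let A := Bigraded hd qd coef in
    is_cochain_complex A /\
    forall i j, isomorphic (cohomology A i j) (cohomology C i j).
Proof.
move=> [dh dd] z_inj zdeg [X [Y [h [eT [XY XZ YZ] hh [Xh hY hdX Ydh]]]]].
pose d : {additive chain C -> chain C} := @differential C.
pose D : {additive chain C -> chain C} := d \- (d \o h \o d).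
pose A := Bigraded hd qd (fun a b => D (basis (z a)) (z b)).
pose inc (c : chain A) : chain C := \sum_a basis (z a) *~ c a.
pose pro (c : chain C) : chain A := [ffun a => c (z a)].
have incE c y : inc c y = \sum_a (z a == y)%:R *~ c a.
  by rewrite sum_ffunE; apply: eq_bigr => a _; rewrite ffunMzE ffunE.
have inc_add : zmod_morphism inc.
  by move=> c c'; rewrite -sumrB; apply: eq_bigr => a _; rewrite !ffunE mulrzBr.
have pro_add : zmod_morphism pro.
  by move=> c c'; apply/ffunP => a; rewrite !ffunE.
pose Inc : {additive chain A -> chain C} :=
  HB.pack inc (GRing.isZmodMorphism.Build _ _ inc inc_add).
pose Pro : {additive chain C -> chain A} :=
  HB.pack pro (GRing.isZmodMorphism.Build _ _ pro pro_add).
have incz c a : inc c (z a) = c a.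
  rewrite incE (bigD1 a) //= eqxx big1 ?addr0 => [|b /negPf ba].
    by rewrite intz.
  by rewrite (inj_eq z_inj) ba mul0rz.
have inc_pro c : inc (pro c) = restr [set z a | a : I] c.
  apply/ffunP => y; rewrite ffunE; case: imsetP => [[a _ ->]|yZ].
    by rewrite incz ffunE.
  rewrite incE big1 // => a _; case: eqP => [e|]; rewrite ?mul0rz //.
  by case: yZ; exists a.
have proX c : pro (restr X c) = 0.
  apply/ffunP => a; rewrite !ffunE ifN //.
  by apply/negP => /(disjointFr XZ)/negP[]; apply: imset_f.
have hinc c : h (inc c) = 0.
  rewrite -hY; suff -> : restr Y (inc c) = 0 by rewrite raddf0.
  apply/ffunP => y; rewrite !ffunE; case: ifP => // yY.
  rewrite incE big1 // => a _; case: eqP => [e|]; rewrite ?mul0rz //.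
  by have /negP[] := disjointFr YZ yY; rewrite -e imset_f.
have proh c : pro (h c) = 0 by rewrite -Xh proX.
have hh0 c : h (h c) = 0.
  rewrite -hY; have -> : restr Y (h c) = 0; last by rewrite raddf0.
  by rewrite -Xh restr_disjoint // disjoint_sym.
have hdh c : h (d (h c)) = h c by rewrite -[LHS]hY Ydh hY.
pose iota : {additive chain A -> chain C} := Inc \- (h \o d \o Inc).
pose rho : {additive chain C -> chain A} := Pro \o (idfun \- (d \o h)).
have hdiota c : h (d (iota c)) = 0.
  by rewrite /= !raddfB /= hdh subrr.
have rdi c : rho (d (iota c)) = pro (D (inc c)).
  rewrite [rho _]/=; congr pro.
  by rewrite [h _](hdiota c) diff0 subr0 diffB.
have dAE c : differential c = rho (d (iota c)).
  rewrite rdi; apply/ffunP => b; rewrite [LHS]ffunE [RHS]ffunE.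
  rewrite raddf_sum sum_ffunE; apply: eq_bigr => a _.
  by rewrite raddfMz ffunMzE mulrzz mulrC.
have rhoK : cancel iota rho.
  move=> c; have hw : h (iota c) = 0 by rewrite /= raddfB /= hinc hh0 subrr.
  rewrite [rho]lock /= -lock -[_ - _]/(iota c) [rho _]/=.
  rewrite [h _]hw diff0 subr0 [LHS](raddfB Pro) /= proh subr0.
  by apply/ffunP => a; rewrite ffunE incz.
have iotarho c : iota (rho c) = c - h (d c) - d (h c).
  rewrite [rho c]/= [iota _]/=; set v := c - d (h c).
  (* [v] has no component on [Y], and [1 - h d] kills the one on [X]. *)
  have Yv : restr Y v = 0 by rewrite raddfB /= Ydh subrr.
  have vE : v = restr X v + restr [set z a | a : I] v.
    rewrite -[LHS]restrT eT restrU ?restrU ?Yv ?addr0 //.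
    by rewrite -setI_eq0 setIUl setU_eq0 !setI_eq0 XZ YZ.
  rewrite inc_pro; have <- : v - restr X v = restr [set z a | a : I] v.
    by rewrite [X in X - _]vE addrC addKr.
  rewrite diffB (raddfB h) hdX opprB addrA subrK diffB dd subr0.
  by rewrite /v addrAC.
have iotad c : d (iota c) = iota (differential c).
  by rewrite dAE iotarho hdiota raddf0 [d (d _)]dd raddf0 !subr0.
have rhod c : differential (rho c) = rho (d c).
  rewrite dAE iotarho [d _]diffB [differential (_ - _)]diffB dd subr0.
  rewrite (raddfB rho).
  rewrite [X in _ - X](_ : _ = 0) ?subr0 //.
  by rewrite /= hdh subrr; exact: (raddf0 Pro).
have iotah i j c : c \in homog A i j -> iota c \in homog C i j.
  move=> ch; have inch : inc c \in homog C i j.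
    apply/homogP => y.
    have [/imsetP[a _ ->]|yZ] := boolP (y \in [set z a | a : I]).
      by rewrite incz; have [-> ->] := zdeg a; move/homogP: ch; apply.
    rewrite incE big1 ?eqxx // => a _; case: eqP => [e|]; rewrite ?mul0rz //.
    by rewrite -e imset_f in yZ.
  by rewrite /= rpredB // hh // dh.
have rhoh i j c : c \in homog C i j -> rho c \in homog A i j.
  move=> ch; have : c - d (h c) \in homog C i j.
    by rewrite rpredB // -[i](subrK 1) dh // hh // subrK.
  move=> /homogP vh; apply/homogP => a /=; rewrite ffunE => /vh.
  by have [-> ->] := zdeg a.
exists (@dcoef A); split; first split=> [i j c ch | c].
- by rewrite dAE; apply/rhoh/dh/iotah.
- by rewrite dAE -iotad [d (d _)]dd raddf0.
apply: (homotopy_equiv_isomorphic (f := iota) (g := rho) (h := h)) => //.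
Qed.

(** * Boundary components of spanning ribbon subgraphs *)

(** Locked: unfolding the orbits of the boundary permutation makes conversion
    tests between distinct arcs intractable. *)
HB.lock Definition same (n : nat) (G : ribbon_graph n) (S : {set 'I_n})
    (a b : disk_arc G) : bool := bdry_at S a == bdry_at S b.
Arguments same.body {n G} S a b.

Section Boundary.
Variables (n : nat) (G : ribbon_graph n).
Implicit Types (S T : {set 'I_n}) (e f i j : 'I_n) (a b c : disk_arc G).

Local Notation same := (@same.body n G).

(** Adding and removing an edge have the same effect on the boundary, a
    surgery at the two arcs ending at its places, so both are treated at once.
    *)
Definition toggle S e : {set 'I_n} := [set i | (i \in S) (+) (i == e)].

Lemma in_toggle S e i : (i \in toggle S e) = (i \in S) (+) (i == e).
Proof. by rewrite inE. Qed.

Lemma toggleK S e : toggle (toggle S e) e = S.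
Proof. by apply/setP => i; rewrite !in_toggle -addbA addbb addbF. Qed.

Lemma toggleC S e f : toggle (toggle S e) f = toggle (toggle S f) e.
Proof. by apply/setP => i; rewrite !in_toggle addbAC. Qed.

Lemma toggle_add S e : e \notin S -> toggle S e = e |: S.
Proof.
move=> eS; apply/setP => i; rewrite in_toggle in_setU1.
by case: (eqVneq i e) => [->|_]; rewrite ?(negPf eS) // addbF.
Qed.

Lemma toggle_remove S e : e \in S -> toggle S e = S :\ e.
Proof.
move=> eS; apply/setP => i; rewrite in_toggle in_setD1.
by case: (eqVneq i e) => [->|_]; rewrite ?eS // addbF.
Qed.

Definition end0 e : disk_arc G := inl (e, false).
Definition end1 e : disk_arc G := inl (e, true).

Lemma same_bdry S a b : same S a b = (bdry_at S a == bdry_at S b).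
Proof. by rewrite same.unlock. Qed.

Lemma sameE S a b : same S a b = (a \in porbit (bdry_perm G S) b).
Proof. by rewrite -eq_porbit_mem same_bdry -val_eqE. Qed.

Lemma same_refl S a : same S a a. Proof. by rewrite same_bdry. Qed.

Lemma same_sym S a b : same S a b = same S b a.
Proof. by rewrite !same_bdry eq_sym. Qed.

Lemma same_trans S b a c : same S a b -> same S b c -> same S a c.
Proof. by rewrite !same_bdry => /eqP->. Qed.

Lemma same_congl S a b c : same S a b -> same S a c = same S b c.
Proof. by rewrite !same_bdry => /eqP->. Qed.

Lemma same_congr S a b c : same S a b -> same S c a = same S c b.
Proof. by rewrite !same_bdry => /eqP->. Qed.

Lemma same_next S a : same S (next_arc S a) a.
Proof.
by rewrite sameE -[next_arc S a](permE (@next_arc_inj n G S)) (mem_porbit _ 1).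
Qed.

Lemma iter_next S k a : iter k (next_arc S) a = (bdry_perm G S ^+ k)%g a.
Proof. by rewrite permX; apply: eq_iter => b; rewrite permE. Qed.

Lemma same_iterP S a b :
  reflect (exists k, b = iter k (next_arc S) a) (same S a b).
Proof.
rewrite same_sym sameE; apply: (iffP (porbitP _ _ _)) => -[k ->]; exists k;
  by rewrite iter_next.
Qed.

(** Where [S] and [S'] differ, the walk along the boundary of one continues as
    the walk along the other does from the opposite half-edge. *)
Lemma next_arc_edge S S' (h : half_edge n) : (h.1 \in S) != (h.1 \in S') ->
  next_arc S (inl h : disk_arc G) = next_arc S' (inl (opp_half h)).
Proof.
rewrite /= /next_half; case: h => e x /=; rewrite /opp_half /=.
by case: (e \in S); case: (e \in S') => //= _; rewrite negbK.
Qed.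

Lemma next_arc_eq S S' (h : half_edge n) : (h.1 \in S) = (h.1 \in S') ->
  next_arc S (inl h : disk_arc G) = next_arc S' (inl h).
Proof. by move=> e; rewrite /= /next_half e. Qed.

(** A boundary component of [S] stays inside one of [S'] if every edge on
    which they differ has both ends on the same component of [S']: passing
    such an end only jumps from one end to the other. *)
Lemma same_coarsen S S' a b :
  (forall h : half_edge n, (h.1 \in S) != (h.1 \in S') ->
     same S' (inl h) (inl (opp_half h))) ->
  same S a b -> same S' a b.
Proof.
move=> opp /same_iterP[k ->]; elim: k => [|k IHk]; first exact: same_refl.
apply: same_trans IHk _; rewrite iterS same_sym.
case: (iter _ _ _) => [h|v]; last exact: same_refl.
have [eh|neh] := eqVneq (h.1 \in S) (h.1 \in S').
  by rewrite (next_arc_eq eh) same_next.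
rewrite (next_arc_edge neh); apply: same_trans (same_next _ _) _.
by rewrite same_sym opp.
Qed.

Lemma iter_next_off S S' a k :
  (forall l (h : half_edge n), (l < k)%N -> iter l (next_arc S) a = inl h ->
     (h.1 \in S) = (h.1 \in S')) ->
  iter k (next_arc S') a = iter k (next_arc S) a.
Proof.
elim: k => // k IHk agree; rewrite !iterS {}IHk => [|l h lk]; last first.
  by apply: agree; apply: ltnW.
case E: (iter k (next_arc S) a) => [h|v] //.
by rewrite (@next_arc_eq S S') // (agree k).
Qed.

(** Along a component that meets no edge on which [S] and [S'] differ, the two
    boundaries take the same turns. *)
Lemma same_off S S' a b :
  (forall h : half_edge n,
     (h.1 \in S) != (h.1 \in S') -> ~~ same S a (inl h)) ->
  same S' a b = same S a b.
Proof.
move=> off.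
suff E k : iter k (next_arc S') a = iter k (next_arc S) a.
  by apply/same_iterP/same_iterP => -[k ->]; exists k; rewrite E.
apply: iter_next_off => l h _ E; apply/eqP/negPn/negP => /off/negP[].
by apply/same_iterP; exists l.
Qed.

Lemma bdry_perm_toggle S e :
  bdry_perm G (toggle S e) = (tperm (end0 e) (end1 e) * bdry_perm G S)%g.
Proof.
apply/permP => a; rewrite permM [LHS]permE [RHS]permE.
case: a => [[i x]|v]; last by rewrite tpermD.
have [->|ie] := eqVneq i e; last first.
  rewrite tpermD; first by rewrite /= /next_half in_toggle (negPf ie) addbF.
    by apply: contra_neq ie => -[->].
  by apply: contra_neq ie => -[->].
rewrite (@next_arc_edge _ S); last first.
  by rewrite in_toggle eqxx; case: (_ \in _).
by case: x; rewrite ?tpermL ?tpermR.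
Qed.

Lemma end01 e : end0 e != end1 e. Proof. by apply/eqP => -[]. Qed.

Definition nb S := #|bdry G S|.

Lemma nbE S : nb S = #|porbits (bdry_perm G S)|.
Proof. by rewrite /nb card_sig; apply: eq_card => c; rewrite !inE. Qed.

Lemma nb_toggle S e :
  (nb (toggle S e) + (~~ same S (end0 e) (end1 e)).*2 = (nb S).+1)%N.
Proof.
have := porbits_mul_tperm (bdry_perm G S) (end0 e) (end1 e).
by rewrite /= -bdry_perm_toggle -!nbE -sameE end01 addn1.
Qed.

(** Merging and splitting undo each other: the number of components changes by
    one each time, and toggling twice gives [S] back. *)
Lemma same_toggle_ends S e :
  same (toggle S e) (end0 e) (end1 e) = ~~ same S (end0 e) (end1 e).
Proof.
have := nb_toggle S e; have := nb_toggle (toggle S e) e; rewrite toggleK.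
case: (same S _ _); case: (same (toggle S e) _ _) => //=; lia.
Qed.

Lemma toggle_diff S e (h : half_edge n) :
  (h.1 \in S) != (h.1 \in toggle S e) -> h.1 = e.
Proof.
by have [//|/negPf ne] := eqVneq h.1 e; rewrite in_toggle ne addbF eqxx.
Qed.

Lemma toggle_ends S e (h : half_edge n) : same S (end0 e) (end1 e) -> h.1 = e ->
  same S (inl h) (inl (opp_half h)).
Proof.
case: h => i [] /= ends ->; rewrite /opp_half //=.
by rewrite same_sym.
Qed.

Lemma toggle_coarsen S e a b : ~~ same S (end0 e) (end1 e) ->
  same S a b -> same (toggle S e) a b.
Proof.
move=> ends; apply: same_coarsen => h /toggle_diff.
by apply: toggle_ends; rewrite same_toggle_ends.
Qed.

Lemma toggle_refine S e a b : same S (end0 e) (end1 e) ->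
  same (toggle S e) a b -> same S a b.
Proof.
move=> ends ab; rewrite -(toggleK S e) toggle_coarsen //.
by rewrite same_toggle_ends negbK.
Qed.

Lemma toggle_off S e a b : ~~ same S a (end0 e) -> ~~ same S a (end1 e) ->
  same (toggle S e) a b = same S a b.
Proof.
move=> a0 a1; apply: same_off => -[i x] /toggle_diff /= ->.
by case: x.
Qed.

Lemma toggle_split S e a : same S (end0 e) (end1 e) -> same S a (end0 e) ->
  same (toggle S e) a (end0 e) || same (toggle S e) a (end1 e).
Proof.
move=> ends a0; apply: contraLR a0; rewrite negb_or => /andP[a0 a1].
by rewrite -{1}(toggleK S e) toggle_off.
Qed.

End Boundary.

(** * Generators as words of arcs *)

Section Generators.
Variables (n : nat) (G : ribbon_graph n).
Implicit Types (S T : {set 'I_n}) (e f i j : 'I_n) (a b c : disk_arc G).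
Implicit Types (x y z : kh_gen G) (w : seq (disk_arc G)).

Lemma label_same x a b : same (tag x) a b -> label x a = label x b.
Proof. by rewrite same_bdry /label => /eqP->. Qed.

Lemma bdry_at_surj S (k : bdry G S) : exists a, bdry_at S a == k.
Proof.
case: k => k kP; have /imsetP[a _ ka] := kP.
by exists a; rewrite -val_eqE /= ka.
Qed.

Lemma kh_gen_ext x y : tag x = tag y -> label x =1 label y -> x = y.
Proof.
case: x y => [S k] [S' k'] /= SS'; case: _ / SS' k' => k' kk'.
congr (Tagged _ _); apply/ffunP => c.
by have [a /eqP<-] := bdry_at_surj c; apply: (kk' a).
Qed.

(** A labelling of the arcs that is constant on boundary components descends
    to them; the universal quantifier avoids choosing an arc of each
    component. *)
Definition mkgen S (l : disk_arc G -> bool) : kh_gen G :=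
  Tagged (fun S => {ffun bdry G S -> bool})
    [ffun k : bdry G S => [forall a in val k, l a]].

Lemma label_mkgen S (l : disk_arc G -> bool) a :
  (forall b c, same S b c -> l b = l c) -> label (mkgen S l) a = l a.
Proof.
move=> lS; rewrite /label /= ffunE.
apply/forall_inP/idP => [|la b]; first by apply; apply: porbit_id.
by rewrite -sameE => /lS->.
Qed.

Definition touched S w a := has (same S a) w.

Lemma touched_same S w a b : same S a b -> touched S w a = touched S w b.
Proof. by move=> ab; apply: eq_has => c; apply: same_congl. Qed.

(** The tensor power of [V] over the components of [S] is the quotient of a
    polynomial ring with one variable for each arc, of square zero, by the
    identification of the variables of arcs of the same component; 1 is v_+
    and the variable is v_-. [word_gen S w] is the class of the product of the
    variables of [w], if this product is not zero. *)
Definition word_gen S w : kh_gen G := mkgen S (fun a => ~~ touched S w a).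

Lemma label_word_gen S w a : label (word_gen S w) a = ~~ touched S w a.
Proof. by apply: label_mkgen => b c bc; rewrite (touched_same _ bc). Qed.

Lemma word_gen_ext S w w' :
  touched S w =1 touched S w' -> word_gen S w = word_gen S w'.
Proof.
move=> ww'; apply: (@kh_gen_ext (word_gen S w) (word_gen S w') (erefl S)) => a.
by rewrite !label_word_gen ww'.
Qed.

(** The product of the variables of [w] is not zero at [S]. *)
Definition indep S w := uniq (map (bdry_at S) w).

Lemma indep_cons S a w : indep S (a :: w) = ~~ touched S w a && indep S w.
Proof.
rewrite /indep /=; congr (~~ _ && _).
apply/mapP/hasP => -[b bw ab]; exists b => //;
  first by rewrite same_bdry; apply/eqP.
by apply/eqP; rewrite -same_bdry.
Qed.

Lemma indep_inj S w a b :
  indep S w -> a \in w -> b \in w -> same S a b -> a = b.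
Proof.
elim: w => // c w IHw; rewrite indep_cons => /andP[/hasPn cw Sw].
rewrite !in_cons => /orP[/eqP->|aw] /orP[/eqP->|bw] ab //.
- by have := cw b bw; rewrite ab.
- by have := cw a aw; rewrite same_sym ab.
- exact: IHw.
Qed.

(** Every generator is a word, which can be made to contain a given arc of a
    component labelled v_-; so reducing at [p] amounts to words that contain
    [p]. *)
Lemma gen_word (p : disk_arc G) x : exists2 w, indep (tag x) w &
  x = word_gen (tag x) w /\ (~~ label x p -> p \in w).
Proof.
pose r k := if bdry_at (tag x) p == k then p else xchoose (bdry_at_surj k).
have rK : cancel r (bdry_at (tag x)).
  move=> k; rewrite /r; case: ifP => [/eqP//|_].
  exact/eqP/(xchooseP (bdry_at_surj k)).
pose w := [seq r k | k <- enum [pred k | ~~ tagged x k]].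
have tw a : touched (tag x) w a = ~~ label x a.
  apply/hasP/idP => [[_ /mapP[k + ->]]|xa].
    by rewrite mem_enum inE => xk ak; rewrite (label_same ak) /label rK.
  exists (r (bdry_at (tag x) a)); last by rewrite same_bdry rK.
  by apply: map_f; rewrite mem_enum.
exists w; first by rewrite /indep -map_comp (eq_map rK) map_id enum_uniq.
split=> [|xp].
  by apply: kh_gen_ext => // a; rewrite label_word_gen tw negbK.
apply/mapP; exists (bdry_at (tag x) p); first by rewrite mem_enum.
by rewrite /r eqxx.
Qed.

Lemma kh_qdeg_word_gen S w : indep S w ->
  kh_qdeg (word_gen S w) = #|S|%:Z + (nb G S)%:Z - (size w)%:Z *+ 2.
Proof.
move=> Sw; rewrite /kh_qdeg -addrA; congr (_ + _).
pose F : pred (bdry G S) := [pred k | k \in map (bdry_at S) w].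
have FE k : tagged (word_gen S w) k = ~~ F k.
  have [a /eqP<-] := bdry_at_surj k.
  rewrite -[LHS]/(label (word_gen S w) a) label_word_gen; congr (~~ _).
  apply/hasP/mapP => -[b bw ab]; exists b => //; first last.
    by rewrite same_bdry; apply/eqP.
  by apply/eqP; rewrite -same_bdry.
have vdegE (t : bool) : vdeg (~~ t) = 1 - (t : nat)%:Z *+ 2 by case: t.
rewrite (eq_bigr (fun k => 1 - (F k : nat)%:Z *+ 2)) => [|k _]; last first.
  by rewrite FE vdegE.
rewrite sumrB sumr_const natz sumrMnl -(big_morph Posz PoszD (erefl _)).
congr (_%:Z - _%:Z *+ 2).
rewrite -[size w](size_map (bdry_at S)) -(card_uniqP Sw).
rewrite -sum1_card [RHS]big_mkcond; apply: eq_bigr => k _.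
by rewrite /F /=; case: (k \in _).
Qed.

End Generators.

(** * The cube differential on words *)

(** The class of the product of the variables of [w], which may be zero;
    locked to keep conversion tests between distinct words cheap. *)
HB.lock Definition mono (n : nat) (G : ribbon_graph n) (S : {set 'I_n})
    (w : seq (disk_arc G)) : chain (CKh G) :=
  if indep S w then basis (C:=CKh G) (word_gen S w) else 0.
Arguments mono.body {n G} S w.

Section Words.
Variables (n : nat) (G : ribbon_graph n).
Implicit Types (S T : {set 'I_n}) (e f i j : 'I_n) (a b c : disk_arc G).
Implicit Types (x y z : kh_gen G) (w : seq (disk_arc G)).

Lemma touched_merge S e w a : ~~ same S (end0 G e) (end1 G e) ->
  touched (toggle S e) w a =
    if same S a (end0 G e) || same S a (end1 G e)
    then touched S w (end0 G e) || touched S w (end1 G e) else touched S w a.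
Proof.
move=> ends; case: ifP => [aE|/norP[a0 a1]]; last first.
  by apply: eq_has => b; apply: toggle_off.
have ends' : same (toggle S e) (end0 G e) (end1 G e).
  by rewrite same_toggle_ends.
have a0 : same (toggle S e) a (end0 G e).
  case/orP: aE => /(toggle_coarsen ends)// a1.
  by rewrite (same_congr _ ends').
rewrite (touched_same _ a0) /touched -has_predU; apply: eq_has => b /=.
apply/idP/orP => [lb|[]/(toggle_coarsen ends)//]; last first.
  by rewrite (same_congl _ ends').
rewrite same_sym in lb; have := toggle_split ends' lb; rewrite toggleK.
by rewrite ![same S b _]same_sym => /orP.
Qed.

(** A product survives the identification of two variables unless it contains
    both of them. *)
Lemma indep_merge S e w : ~~ same S (end0 G e) (end1 G e) ->
  indep (toggle S e) w =
    indep S w && ~~ (touched S w (end0 G e) && touched S w (end1 G e)).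
Proof.
move=> ends; elim: w => // a w IHw.
rewrite !indep_cons IHw (touched_merge _ _ ends) /touched /= -!/(touched _ _ _).
rewrite ![same S _ a]same_sym.
have [a0|_] := boolP (same S a (end0 G e)).
  rewrite (same_congl _ a0) (negPf ends) (touched_same _ a0) /=.
  by case: (touched S w _); case: (touched S w _); rewrite ?andbF.
have [a1|_] := boolP (same S a (end1 G e)).
  rewrite (touched_same _ a1) /=.
  by case: (touched S w _); case: (touched S w _); rewrite ?andbF.
by rewrite /= andbA.
Qed.

Lemma monoE S w :
  mono S w = if indep S w then basis (C:=CKh G) (word_gen S w) else 0.
Proof. by rewrite mono.unlock. Qed.

Lemma mono_swap S a b w : mono S [:: a, b & w] = mono S [:: b, a & w].
Proof.
have -> : mono S [:: a, b & w] =
    if indep S [:: a, b & w] then basis (C:=CKh G) (word_gen S [:: b, a & w])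
    else 0.
  rewrite monoE.
  suff -> : word_gen S [:: a, b & w] = word_gen S [:: b, a & w] by [].
  by apply: word_gen_ext => c; rewrite /touched /= orbCA.
rewrite !monoE !indep_cons /touched /= [same S b a]same_sym !negb_or.
by rewrite -!andbA; case: (~~ same S a b); rewrite //= andbCA.
Qed.

Lemma mono_same S a b w : same S a b -> mono S (a :: w) = mono S (b :: w).
Proof.
move=> ab; rewrite !monoE !indep_cons (touched_same _ ab).
suff -> : word_gen S (a :: w) = word_gen S (b :: w) by [].
by apply: word_gen_ext => c; rewrite /touched /= (same_congr _ ab).
Qed.

Definition edge_coef e x y : int :=
  if (e \notin tag x) && (tag y == e |: tag x) then dxi_coef e x y else 0.

Definition edge_map e (c : chain (CKh G)) : chain (CKh G) :=
  [ffun y => \sum_x c x * edge_coef e x y].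

Lemma edge_mapD e : {morph edge_map e : c d / c + d >-> c + d}.
Proof.
move=> c d; apply/ffunP => y; rewrite !ffunE -big_split.
by apply: eq_bigr => x _; rewrite ffunE mulrDl.
Qed.

Lemma edge_map0 e : edge_map e 0 = 0.
Proof.
by apply/ffunP => y; rewrite !ffunE big1 // => x _; rewrite ffunE mul0r.
Qed.

Lemma edge_map_basis e x y : edge_map e (@basis (CKh G) x) y = edge_coef e x y.
Proof.
rewrite ffunE (bigD1 x) //= ffunE eqxx mul1r big1 ?addr0 // => z /negPf zx.
by rewrite ffunE eq_sym zx mul0r.
Qed.

Lemma basis_word S w y : tag y = S ->
  basis (C:=CKh G) (word_gen S w) y =
    [forall a, label y a == ~~ touched S w a]%:R.
Proof.
move=> yS; rewrite ffunE.
suff -> : (word_gen S w == y) = [forall a, label y a == ~~ touched S w a] by [].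
apply/eqP/forallP => [<- a|yw]; first by rewrite label_word_gen.
apply: (@kh_gen_ext _ _ (word_gen S w) y (esym yS)) => a.
by rewrite label_word_gen (eqP (yw a)).
Qed.

Lemma mono_at S w y : tag y = S -> mono S w y =
  if indep S w then [forall a, label y a == ~~ touched S w a]%:R else 0.
Proof.
by move=> yS; rewrite monoE; case: ifP; rewrite ?basis_word // ffunE.
Qed.

Definition away S e a := ~~ same S a (end0 G e) && ~~ same S a (end1 G e).

Lemma touched_away S e w a :
  away S e a -> touched (toggle S e) w a = touched S w a.
Proof. by move=> /andP[a0 a1]; apply: eq_has => b; apply: toggle_off. Qed.

Lemma labels_from_ends S e w y : tag y = toggle S e ->
  [forall a, label y a == ~~ touched (toggle S e) w a] =
    [&& [forall a, away S e a ==> (label y a == ~~ touched S w a)],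
        label y (end0 G e) == ~~ touched (toggle S e) w (end0 G e) &
        label y (end1 G e) == ~~ touched (toggle S e) w (end1 G e)].
Proof.
move=> yS; apply/forallP/and3P => [yw | [yw y0 y1] a].
  split; try exact: yw; apply/forallP => a; apply/implyP => aw.
  by rewrite -(touched_away w aw).
have [aw|] := boolP (away S e a).
  by rewrite touched_away //; move/forallP/(_ a)/implyP: yw; apply.
rewrite /away negb_and !negbK => aE.
have : same (toggle S e) a (end0 G e) || same (toggle S e) a (end1 G e).
  have [ends|ends] := boolP (same S (end0 G e) (end1 G e)).
    apply: toggle_split => //; case/orP: aE => // a1.
    by rewrite (same_congr _ ends).
  by case/orP: aE => /(toggle_coarsen ends)->; rewrite ?orbT.
case/orP=> ab; rewrite (touched_same _ ab); rewrite -yS in ab;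
  by rewrite (label_same ab).
Qed.

Lemma chainD (C : bigraded) (c d : chain C) (y : gen C) : (c + d) y = c y + d y.
Proof. by rewrite ffunE. Qed.

(** The merge is the quotient map of the polynomial rings, and the split is
    the multiplication by the sum of the variables at the two ends of [e]; so
    both are linear over the polynomial ring, and determined by the image of
    1. *)
Lemma edge_map_mono e S w : e \notin S ->
  edge_map e (mono S w) =
    if same S (end0 G e) (end1 G e)
    then mono (toggle S e) (end0 G e :: w) + mono (toggle S e) (end1 G e :: w)
    else mono (toggle S e) w.
Proof.
move=> eS; apply/ffunP => y.
have [yS'|yS'] := eqVneq (tag y) (toggle S e); last first.
  have m0 w' : mono (toggle S e) w' y = 0.
    rewrite !monoE; case: ifP => _; rewrite ffunE //.
    by case: eqP => // yE; rewrite -yE eqxx in yS'.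
  have -> : edge_map e (mono S w) y = 0.
    rewrite ffunE big1 // => x _; rewrite !monoE; case: ifP => _; last first.
      by rewrite ffunE mul0r.
    rewrite ffunE; case: eqP => [<-|_]; rewrite ?mul0r // /edge_coef /=.
    by rewrite -toggle_add // (negPf yS') andbF mulr0.
  case: ifP => _; last by rewrite m0.
  rewrite chainD.
  by rewrite !m0 addr0.
rewrite {1}monoE; case: ifP => Sw; last first.
  rewrite edge_map0 ffunE; case: ifPn => ends.
    have ends' : ~~ same (toggle S e) (end0 G e) (end1 G e).
      by rewrite same_toggle_ends ends.
    move: Sw; rewrite -(toggleK S e) (indep_merge _ ends') toggleK.
    rewrite !monoE !indep_cons ffunE.
    case: (indep _ w) => /= [|_]; last by rewrite !andbF !ffunE.
    by move=> /negbFE/andP[-> ->]; rewrite !ffunE.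
  by rewrite !monoE indep_merge // Sw ffunE.
rewrite edge_map_basis /edge_coef /= -toggle_add // eS yS' eqxx /=.
rewrite /dxi_coef /= -!same_bdry !label_word_gen.
set off := [forall a, _ ==> _].
have offE : off = [forall a, away S e a ==> (label y a == ~~ touched S w a)].
  apply: eq_forallb => a.
  by rewrite /= -!same_bdry label_word_gen [label y a == _]eq_sym.
rewrite {off}offE.
have [sp|mg] := boolP (same S (end0 G e) (end1 G e)).
  have ns : ~~ same (toggle S e) (end0 G e) (end1 G e).
    by rewrite same_toggle_ends sp.
  have tE : touched S w (end0 G e) = touched (toggle S e) w (end0 G e) ||
                                     touched (toggle S e) w (end1 G e).
    by have := touched_merge w (end0 G e) ns; rewrite toggleK same_refl.
  have := indep_merge w ns; rewrite toggleK Sw => /esym/andP[Sw' t01].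
  rewrite (@chainD (CKh G)) !mono_at // !indep_cons Sw' !andbT.
  have away_eq b : same S b (end0 G e) ->
      [forall a, away S e a ==> (label y a == ~~ touched S (b :: w) a)] =
      [forall a, away S e a ==> (label y a == ~~ touched S w a)].
    move=> b0; apply: eq_forallb => a; have [aw|//] := boolP (away S e a).
    by rewrite /touched /= (same_congr _ b0); case/andP: aw => /negPf->.
  rewrite !labels_from_ends // !away_eq ?same_refl //; last by rewrite same_sym.
  rewrite tE /touched /= !same_refl [same _ (end1 G e) (end0 G e)]same_sym.
  rewrite (negPf ns) -!/(touched _ _ _) /=.
  case: [forall a, _] => /=; last by do 2!case: ifP.
  move: t01; case: (touched _ w _); case: (touched _ w _) => //= _;
    case: (label y _); case: (label y _) => //=.
have sy : same (tag y) (end1 G e) (end0 G e).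
  by rewrite yS' same_sym same_toggle_ends mg.
rewrite mono_at // indep_merge // Sw /=.
rewrite labels_from_ends // (label_same sy) !touched_merge // !same_refl.
rewrite orbT /=.
rewrite andbb; case: [forall a, _] => /=; last by case: ifP.
by do 2!case: (touched _ w _); case: (label y _).
Qed.



(** Adding two edges changes the number of boundary components by the same
    amount in both orders, so the two orders have as many splits. *)
Lemma same_toggle2 S e f :
  (same S (end0 G e) (end1 G e) + same (toggle S e) (end0 G f) (end1 G f) =
   same S (end0 G f) (end1 G f) + same (toggle S f) (end0 G e) (end1 G e))%N.
Proof.
have := nb_toggle G S e; have := nb_toggle G (toggle S e) f.
have := nb_toggle G S f; have := nb_toggle G (toggle S f) e.
rewrite [toggle (toggle S f) e]toggleC.
move: (nb G (toggle (toggle S e) f)) (nb G (toggle S e)) (nb G (toggle S f)).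
move: (nb G S) (same S _ _) (same S _ _) (same (toggle S e) _ _).
by move: (same (toggle S f) _ _) => [] k [] [] [] k1 k2 k3 /=; lia.
Qed.

(** By linearity, a square of the cube commutes if the factors picked up along
    its two sides agree. They visibly do unless one side splits with [e] only
    and the other with [f] only; then the sums of the variables at the ends of
    [e] and of [f] have to be compared at the last vertex. *)
Lemma edge_mapC S e f w : e \notin S -> f \notin S -> e != f ->
  edge_map f (edge_map e (mono S w)) = edge_map e (edge_map f (mono S w)).
Proof.
move=> eS fS ef.
have fSe : f \notin toggle S e by rewrite in_toggle (negPf fS) eq_sym.
have eSf : e \notin toggle S f by rewrite in_toggle (negPf eS).
rewrite (edge_map_mono _ eS) (edge_map_mono _ fS).
rewrite !(fun_if (edge_map _)) !edge_mapD.
rewrite !(edge_map_mono _ fSe) !(edge_map_mono _ eSf).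
rewrite [toggle (toggle S f) e]toggleC; set S2 := toggle (toggle S e) f.
have endsf := same_toggle_ends G (toggle S e) f; rewrite -/S2 in endsf.
have endse := same_toggle_ends G (toggle S f) e; rewrite toggleC -/S2 in endse.
have := same_toggle2 S e f.
have [ee|ee] := boolP (same S (end0 G e) (end1 G e));
  have [ff|ff] := boolP (same S (end0 G f) (end1 G f));
  have [fe|fe] := boolP (same (toggle S e) (end0 G f) (end1 G f));
  have [ef'|ef'] := boolP (same (toggle S f) (end0 G e) (end1 G e)) => // _.
- rewrite ![mono S2 [:: end0 G e, _ & _]]mono_swap.
  by rewrite ![mono S2 [:: end1 G e, _ & _]]mono_swap addrACA.
(* Crossing chords on one component: split, then merge.  All four ends lie on
   the same component at the last vertex. *)
- rewrite fe in endsf; rewrite ef' in endse.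
  have f0e : same S (end0 G f) (end0 G e).
    apply: contraR fe => f0e0.
    by rewrite toggle_off // -(same_congr _ ee).
  have {}f0e : same S2 (end0 G f) (end0 G e).
    case/orP: (toggle_split ee f0e) => /(toggle_coarsen fe) //.
    by rewrite -/S2 -(same_congr _ endse).
  rewrite -(mono_same w endse) -(mono_same w endsf).
  by rewrite (mono_same w f0e).
(* Parallel bands between two components: merge, then split.  The ends of [e]
   are separated at the last vertex as those of [f] are. *)
- rewrite fe in endsf; rewrite ef' in endse.
  have e01 : same (toggle S e) (end0 G e) (end1 G e).
    by rewrite same_toggle_ends.
  have e0f : same (toggle S e) (end0 G e) (end0 G f).
    rewrite same_sym; apply: contraLR fe => f0e0.
    rewrite toggle_off //; apply: contra f0e0; first exact: toggle_coarsen.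
    by rewrite (same_congr _ e01); apply: toggle_coarsen.
  have := toggle_split fe e0f; rewrite -/S2.
  have e1f : same (toggle S e) (end1 G e) (end0 G f).
    by rewrite -(same_congl _ e01).
  have := toggle_split fe e1f; rewrite -/S2.
  case/orP=> e1; case/orP=> e0.
  + by case/negP: endse; rewrite (same_congl _ e0) same_sym.
  + by rewrite (mono_same w e0) (mono_same w e1) addrC.
  + by rewrite (mono_same w e0) (mono_same w e1).
  + by case/negP: endse; rewrite (same_congl _ e0) same_sym.
Qed.

Lemma edge_coefC e f x z : e != f ->
  \sum_y edge_coef e x y * edge_coef f y z =
  \sum_y edge_coef f x y * edge_coef e y z.
Proof.
move=> ef.
have comp g h : \sum_y edge_coef g x y * edge_coef h y z =
    edge_map h (edge_map g (basis (C:=CKh G) x)) z.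
  by rewrite [RHS]ffunE; apply: eq_bigr => y _; rewrite edge_map_basis.
have zero g h : g \in tag x -> \sum_y edge_coef g x y * edge_coef h y z = 0.
  by move=> gx; apply: big1 => y _; rewrite /edge_coef gx mul0r.
have zero' g h : h \in tag x -> \sum_y edge_coef g x y * edge_coef h y z = 0.
  move=> hx; apply: big1 => y _; rewrite /edge_coef.
  case: ifP; rewrite ?mul0r // => /andP[_ /eqP->].
  by rewrite in_setU1 hx orbT mulr0.
have [ex|ex] := boolP (e \in tag x); first by rewrite zero // zero'.
have [fx|fx] := boolP (f \in tag x); first by rewrite zero' // zero.
have [w xw [xE _]] := gen_word (end0 G e) x.
rewrite !comp.
have -> : basis (C:=CKh G) x = mono (tag x) w by rewrite monoE xw -xE.
by rewrite edge_mapC.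
Qed.

Lemma edge_coef_word e S w y : indep S w -> edge_coef e (word_gen S w) y != 0 ->
  [/\ e \notin S, tag y = toggle S e & exists2 w',
       indep (toggle S e) w' /\ y = word_gen (toggle S e) w' &
       {subset w <= w'} /\ (size w' = size w + same S (end0 G e) (end1 G e))%N].
Proof.
move=> Sw exy.
have [eS yS] : e \notin S /\ tag y = toggle S e.
  move: exy; rewrite /edge_coef /=; case: ifP; rewrite ?eqxx //.
  by move=> /andP[eS /eqP->] _; rewrite toggle_add.
split=> //; move: exy; rewrite -edge_map_basis.
have -> : basis (C:=CKh G) (word_gen S w) = mono S w by rewrite monoE Sw.
have mono_neq0 w' : mono (toggle S e) w' y != 0 ->
    indep (toggle S e) w' /\ y = word_gen (toggle S e) w'.
  rewrite monoE; case: ifP => ind; rewrite ffunE ?eqxx //.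
  by case: (word_gen _ w' =P y) => [<-|_]; rewrite ?eqxx.
rewrite edge_map_mono //; case: ifP => _.
  rewrite (@chainD (CKh G)).
  have [m0|/mono_neq0 m _] := eqVneq (mono (toggle S e) (end0 G e :: w) y) 0.
    rewrite m0 add0r => /mono_neq0 m; exists (end1 G e :: w) => //.
    by split=> [b|]; rewrite ?inE /= ?addn1 // => ->; rewrite orbT.
  exists (end0 G e :: w) => //.
  by split=> [b|]; rewrite ?inE /= ?addn1 // => ->; rewrite orbT.
by move=> /mono_neq0 m; exists w => //; split; rewrite ?addn0.
Qed.

Lemma edge_coef_away e x y a :
  edge_coef e x y != 0 -> away (tag x) e a -> label x a = label y a.
Proof.
rewrite /edge_coef; case: ifP => [_|]; rewrite ?eqxx // /dxi_coef.
case: ifP => [/forallP xy _ /andP[a0 a1]|]; last by rewrite eqxx.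
by apply/eqP; move/implyP: (xy a); apply; rewrite -!same_bdry a0 a1.
Qed.

Lemma edge_coef_label e x y p :
  edge_coef e x y != 0 -> ~~ label x p -> ~~ label y p.
Proof.
have [w xw [xE pw]] := gen_word p x; rewrite {1}xE.
move=> /(edge_coef_word xw)[_ _ [w' [_ ->] [ww' _]]] /pw /ww' pw'.
by rewrite label_word_gen negbK; apply/hasP; exists p; rewrite ?same_refl.
Qed.

Lemma edge_coef_deg e x y : edge_coef e x y != 0 ->
  kh_hdeg y = kh_hdeg x + 1 /\ kh_qdeg y = kh_qdeg x.
Proof.
have [w xw [xE _]] := gen_word (end0 G e) x; rewrite {1}xE.
move=> /(edge_coef_word xw)[eS yS [w' [w'i ->] [_ sw']]].
have cS : #|toggle (tag x) e| = #|tag x|.+1 by rewrite toggle_add // cardsU1 eS.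
split; first by rewrite /kh_hdeg /= cS -addn1 PoszD.
rewrite [in RHS]xE !kh_qdeg_word_gen // cS sw'.
have := nb_toggle G (tag x) e; case: (same _ _ _) => /=; lia.
Qed.

Definition edge_sign e S : int := (-1) ^+ #|[set i in S | (i < e)%N]|.

Lemma kh_coefE x y : kh_coef x y = \sum_e edge_sign e (tag x) * edge_coef e x y.
Proof.
rewrite /kh_coef big_mkcond; apply: eq_bigr => e _.
by rewrite /edge_coef; case: ifP; rewrite ?mulr0.
Qed.

Lemma edge_sign_add e f S : e \notin S ->
  edge_sign f (e |: S) = (-1) ^+ (e < f)%N * edge_sign f S.
Proof.
move=> eS; rewrite /edge_sign -exprD; congr (_ ^+ _).
have [ef|ef] := boolP (e < f)%N.
  rewrite (_ : [set i in e |: S | _] = e |: [set i in S | (i < f)%N]).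
    by rewrite cardsU1 inE (negPf eS).
  apply/setP => i; rewrite !inE; case: (eqVneq i e) => // -> /=.
  by rewrite ef.
rewrite add0n; apply: eq_card => i; rewrite !inE.
by case: (eqVneq i e) => // ->; rewrite (negPf ef) !andbF.
Qed.

(** The squares of the cube commute and the signs make them anticommute. *)
Lemma kh_coef_sq x z : \sum_y kh_coef x y * kh_coef y z = 0.
Proof.
pose F e f := edge_sign e (tag x) * edge_sign f (tag x) * (-1) ^+ (e < f)%N *
  \sum_y edge_coef e x y * edge_coef f y z.
have -> : \sum_y kh_coef x y * kh_coef y z = \sum_e \sum_f F e f.
  transitivity (\sum_y \sum_e \sum_f (edge_sign e (tag x) *
      edge_sign f (tag x) * (-1) ^+ (e < f)%N *
      (edge_coef e x y * edge_coef f y z))).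
    apply: eq_bigr => y _; rewrite kh_coefE mulr_suml; apply: eq_bigr => e _.
    rewrite kh_coefE mulr_sumr; apply: eq_bigr => f _.
    rewrite {1 3}/edge_coef; case: ifP => [/andP[ex /eqP yE]|_]; last first.
      by rewrite !(mul0r, mulr0).
    by rewrite {1}yE edge_sign_add //; ring.
  rewrite exchange_big; apply: eq_bigr => e _; rewrite exchange_big.
  by apply: eq_bigr => f _; rewrite /F mulr_sumr.
have FC e f : F e f = - F f e.
  rewrite /F; case: (ltngtP e f) => [ef|fe|/val_inj->].
  - rewrite edge_coefC; last by apply: contraTneq ef => ->; rewrite ltnn.
    by rewrite expr0 expr1; ring.
  - rewrite edge_coefC; last by apply: contraTneq fe => ->; rewrite ltnn.
    by rewrite expr0 expr1; ring.
  rewrite big1 ?mulr0 ?oppr0 // => y _.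
  rewrite /edge_coef; case: ifP => [/andP[_ /eqP->]|]; last by rewrite mul0r.
  by rewrite setU11 mulr0.
have : \sum_e \sum_f F e f = - \sum_e \sum_f F e f.
  rewrite {1}exchange_big -sumrN; apply: eq_bigr => e _.
  by rewrite -sumrN; apply: eq_bigr => f _; apply: FC.
by move: (\sum_e _) => s; lia.
Qed.

End Words.

(** * Collapsing the cube of a noncrossing family of chords *)

Section Reduced.
Variables (n : nat) (G : ribbon_graph n) (p : disk_arc G).
Implicit Types (S T N : {set 'I_n}) (e f i j : 'I_n) (a b c : disk_arc G).
Implicit Types (x y z : rkh_gen p) (w : seq (disk_arc G)).

Lemma kh_coef_neq0 (x y : kh_gen G) : kh_coef x y != 0 ->
  exists2 e, edge_coef e x y != 0 & e \notin tag x /\ tag y = e |: tag x.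
Proof.
rewrite kh_coefE => xy; have [e exy] : exists e, edge_coef e x y != 0.
  apply/existsP; apply: contraNT xy => /existsPn exy; rewrite big1 // => e _.
  by have := exy e; rewrite negbK => /eqP->; rewrite mulr0.
exists e => //; move: exy; rewrite /edge_coef.
by case: ifP; rewrite ?eqxx // => /andP[? /eqP].
Qed.

Lemma rCKh_is_cochain_complex : is_cochain_complex (rCKh p).
Proof.
split=> [i j c /homogP ch | c].
  apply/homogP => z; rewrite ffunE => cz.
  have [y cyz] : exists y : gen (rCKh p), c y * dcoef y z != 0.
    apply/existsP; apply: contraNT cz => /existsPn cyz; rewrite big1 // => y _.
    by have := cyz y; rewrite negbK => /eqP.
  move: cyz; rewrite mulf_eq0 negb_or => /andP[/ch[<- <-]].
  move=> /kh_coef_neq0[e /edge_coef_deg[hz qz] _] /=.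
  by rewrite hz qz.
apply/ffunP => z; rewrite !ffunE.
under eq_bigr do rewrite ffunE mulr_suml.
rewrite exchange_big big1 // => x _; under eq_bigr do rewrite -mulrA.
rewrite -mulr_sumr; apply/eqP; rewrite mulf_eq0; apply/orP; right; apply/eqP.
(* The terms outside the reduced complex vanish, as the label v_- at [p] is
   preserved. *)
rewrite -[RHS](kh_coef_sq (val x) (val z)).
rewrite [RHS](bigID (fun y : kh_gen G => ~~ label y p)) /=.
rewrite [X in _ + X]big1 ?addr0 => [|y yp]; last first.
  have [->|] := eqVneq (kh_coef (val x) y) 0; first by rewrite mul0r.
  case/kh_coef_neq0 => e /edge_coef_label/(_ (valP x))/negPf yp' _.
  by rewrite yp' in yp.
rewrite (reindex_omap (val : rkh_gen p -> kh_gen G) insub) /=.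
  by apply: eq_bigl => y; rewrite valK eqxx (valP y).
by move=> y yp; rewrite insubT.
Qed.

Lemma next_arc_fconnect S a b : same S a b -> fconnect (next_arc S) a b.
Proof. by case/same_iterP=> k ->; apply: fconnect_iter. Qed.

(** Read the boundary circle from the arc of [p]. The chord whose first end
    comes last is innermost: the first ends of the other chords come before
    it, hence lie on the side of [p], and their second ends follow because the
    chords do not cross. *)
Lemma innermost S N : N != set0 ->
  {in N, forall f, same S (end0 G f) p /\ same S (end1 G f) p} ->
  {in N &, forall f g, f != g -> same (toggle S f) (end0 G g) (end1 G g)} ->
  exists2 e, e \in N & {in N, forall f, f != e ->
    same (toggle S e) (end0 G f) p /\ same (toggle S e) (end1 G f) p}.
Proof.
move=> /set0Pn[e0 e0N] inp nocross.
pose pos a := findex (next_arc S) p a.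
pose lo f := minn (pos (end0 G f)) (pos (end1 G f)).
have [e eN loe] := arg_maxnP lo e0N; exists e => // f fN fe.
have ef : e != f by rewrite eq_sym.
have f01 := nocross e f eN fN ef.
suff [c fc cp] : exists2 c, c = end0 G f \/ c = end1 G f &
    same (toggle S e) c p.
  case: fc => cE; rewrite cE in cp; split=> //; apply: same_trans cp.
    by rewrite same_sym.
  by [].
have [c fc cE] : exists2 c, c = end0 G f \/ c = end1 G f & pos c = lo f.
  rewrite /lo; case: leqP => _; [exists (end0 G f) | exists (end1 G f)] => //;
    by [left | right].
exists c => //.
have pc : fconnect (next_arc S) p c.
  apply: next_arc_fconnect; rewrite same_sym.
  by case: (inp f fN) => ? ?; case: fc => ->.
rewrite same_sym; apply/same_iterP; exists (pos c).
rewrite (@iter_next_off _ _ S) ?iter_findex // => l h lc hE.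
rewrite in_toggle; have [he|] := eqVneq h.1 e; last by rewrite addbF.
have posh : pos (inl h) = l.
  by rewrite -hE /pos findex_iter // (ltn_trans lc) // findex_max.
have : (lo e <= pos (inl h))%N.
  by case: (h) he => i [] /= ->; rewrite /lo geq_min leqnn ?orbT.
by rewrite posh leqNgt (leq_trans lc) // cE; apply: loe.
Qed.

(** The subcube of the edge sets that differ from [S] inside [N], with the
    labels of all boundary components of [S] but the one of [p] held fixed as
    in [w]. This is meant for edges [N] with both ends on the component of
    [p], so that the other components are never touched. *)
Definition disk S N w : {set rkh_gen p} :=
  [set x : rkh_gen p |
    [forall i, ((i \in tag (val x)) != (i \in S)) ==> (i \in N)] &&
    [forall a, ~~ same S a p ==> (label (val x) a == ~~ touched S w a)]].

Lemma diskP S N w x : reflect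
  ((forall i, (i \in tag (val x)) != (i \in S) -> i \in N) /\
   (forall a, ~~ same S a p -> label (val x) a = ~~ touched S w a))
  (x \in disk S N w).
Proof.
rewrite inE; apply: (iffP andP) => -[/= tx lx]; split.
- by move=> i; apply/implyP; move/forallP: tx; apply.
- by move=> a ap; apply/eqP; move/forallP/(_ a)/implyP: lx; apply.
- by apply/forallP => i; apply/implyP/tx.
- by apply/forallP => a; apply/implyP => /lx->.
Qed.

Definition near_end S e :=
  if same (toggle S e) p (end0 G e) then end0 G e else end1 G e.

Definition far_end S e :=
  if same (toggle S e) p (end0 G e) then end1 G e else end0 G e.

(** The far circle survives with label v_- if [e] is removed from [S]. *)
Definition peel_word S e w := if e \in S then far_end S e :: w else w.

(** One step of the collapse. Toggling the innermost chord [e] splits the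
    circle of [p] into a near circle, which carries [p] and all other chords,
    and a far circle, which no other chord touches. Among the generators for
    which [e] is cut, those whose far label is v_+ if [e] is added, v_- if it
    is removed, form the same problem for one chord fewer; the others cancel.
    *)
Section Peel.
Variables (S : {set 'I_n}) (N : {set 'I_n}) (w : seq (disk_arc G)) (e : 'I_n).
Hypotheses (eN : e \in N) (Sw : indep S w) (pw : p \in w).
Hypothesis inp : {in N, forall f, same S (end0 G f) p /\ same S (end1 G f) p}.
Hypothesis away_e : {in N, forall f, f != e ->
    same (toggle S e) (end0 G f) p /\ same (toggle S e) (end1 G f) p}.
Let S1 := toggle S e.
Let N1 := N :\ e.
Let near := near_end S e.
Let far := far_end S e.
Let w1 := peel_word S e w.

Let Sends : same S (end0 G e) (end1 G e).
Proof. by have [e0 e1] := inp eN; rewrite (same_congl _ e0) same_sym. Qed.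

Let S1ends : ~~ same S1 (end0 G e) (end1 G e).
Proof. by rewrite same_toggle_ends Sends. Qed.

Let near_p : same S1 p near.
Proof.
have pe : same S p (end0 G e) by rewrite same_sym; have [] := inp eN.
have := toggle_split Sends pe; rewrite /near /near_end -/S1.
by case: ifP => // ->.
Qed.

Let near_far : ~~ same S1 near far.
Proof.
rewrite /near /far /near_end /far_end.
by case: ifP => _ //; rewrite same_sym.
Qed.

Let far_p : ~~ same S1 far p.
Proof. by rewrite same_sym (same_congl _ near_p). Qed.

Let ends_near_far T : same T (end0 G e) (end1 G e) = same T near far.
Proof.
rewrite /near /far /near_end /far_end.
by case: ifP => _ //; rewrite same_sym.
Qed.

Let ends_or T c : same T c (end0 G e) || same T c (end1 G e) =
  same T c near || same T c far.
Proof.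
by rewrite /near /far /near_end /far_end; case: ifP; rewrite // orbC.
Qed.

Let S_far_p : same S far p.
Proof. by rewrite /far /far_end; have [] := inp eN; case: ifP. Qed.

Let S_split c : same S c p -> same S1 c p || same S1 c far.
Proof.
move=> cp; have ce : same S c (end0 G e).
  by apply: same_trans cp _; rewrite same_sym; have [] := inp eN.
rewrite !(same_congr c near_p).
have := toggle_split Sends ce; rewrite /near /far /near_end /far_end -/S1.
by case: ifP; rewrite // orbC.
Qed.

Let far_orbit T c : (forall i, (i \in T) != (i \in S1) -> i \in N1) ->
  same T far c = same S1 far c.
Proof.
move=> TN1; apply: same_off => -[i b] /=; rewrite eq_sym => /TN1.
rewrite in_setD1 => /andP[ie iN]; have [i0 i1] := away_e iN ie.
by case: b; rewrite (same_congr _ i0, same_congr _ i1) far_p.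
Qed.

Let away_far T i : (forall i, (i \in T) != (i \in S1) -> i \in N1) ->
  i \in N1 -> away T i far.
Proof.
move=> TN1; rewrite in_setD1 => /andP[ie iN]; have [i0 i1] := away_e iN ie.
by rewrite /away !far_orbit // (same_congr _ i0) (same_congr _ i1) far_p.
Qed.

Let touched_w1 c : ~~ same S1 c p ->
  touched S1 w1 c = if same S1 c far then e \in S else touched S w c.
Proof.
move=> cp.
have w1E : touched S1 w1 c = (e \in S) && same S1 c far || touched S1 w c.
  by rewrite /w1 /peel_word; case: ifP.
case: ifP => cf; rewrite w1E ?cf ?andbT ?andbF /=.
  case: (boolP (touched S1 w c)); rewrite ?orbF // => /hasP[d dw cd].
  have : same S d p.
    rewrite -(same_congl _ (toggle_refine Sends cd)).
    by rewrite (same_congl _ (toggle_refine Sends cf)).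
  by move=> /(indep_inj Sw dw pw) dp; rewrite -dp cd in cp.
have Scp : ~~ same S c p by apply/negP => /S_split; rewrite cf (negPf cp).
have away_c : away S e c.
  have [e0 e1] := inp eN.
  by rewrite /away (same_congr _ e0) (same_congr _ e1) Scp.
exact: touched_away.
Qed.

(** [e] is cut in [T] if it has been toggled from [S], so that the far circle
    is a boundary component of [T]. *)
Let cut T := (e \in T) != (e \in S).
Let D := disk S N w.

Let cut_diff T : (forall i, (i \in T) != (i \in S) -> i \in N) -> cut T ->
  forall i, (i \in T) != (i \in S1) -> i \in N1.
Proof.
move=> TN cT i; rewrite in_toggle in_setD1; have [->|ie] := eqVneq i e.
  by move: cT; rewrite /cut; case: (_ \in T); case: (_ \in S).
by rewrite addbF => /TN.
Qed.

Let cut_toggle T : cut (toggle T e) = ~~ cut T.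
Proof. by rewrite /cut in_toggle eqxx; case: (_ \in T); case: (_ \in S). Qed.

Let toggle_in T : (forall i, (i \in T) != (i \in S) -> i \in N) ->
  forall i, (i \in toggle T e) != (i \in S) -> i \in N.
Proof.
move=> TN i; rewrite in_toggle.
by have [->|ie] := eqVneq i e; rewrite // addbF => /TN.
Qed.

Let far_off_disk c : ~~ same S c p -> ~~ same S1 far c.
Proof.
apply: contra => fc; apply: same_trans S_far_p.
by rewrite same_sym; apply: toggle_refine Sends fc.
Qed.

Let uncut_near_far T : (forall i, (i \in T) != (i \in S) -> i \in N) ->
  ~~ cut T -> same T (end0 G e) (end1 G e).
Proof.
move=> TN uT; have cT' : cut (toggle T e) by rewrite cut_toggle.
rewrite -(toggleK T e) same_toggle_ends ends_near_far same_sym.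
by rewrite (far_orbit _ (cut_diff (toggle_in TN) cT')) same_sym.
Qed.

Let cut_near_far T : (forall i, (i \in T) != (i \in S) -> i \in N) ->
  cut T -> ~~ same T (end0 G e) (end1 G e).
Proof.
move=> TN cT; rewrite ends_near_far same_sym.
by rewrite (far_orbit _ (cut_diff TN cT)) same_sym.
Qed.

Let peel_disk x : (x \in disk S1 N1 w1) =
  [&& x \in D, cut (tag (val x)) & label (val x) far == (e \notin S)].
Proof.
apply/idP/and3P => [/diskP[tx lx]|[/diskP[tx lx] cx /eqP lf]].
  split; last by rewrite lx // touched_w1 // same_refl.
    apply/diskP; split=> [i|a ap].
      have := tx i; rewrite in_toggle in_setD1; have [->//|ie] := eqVneq i e.
      by rewrite addbF => iN1 /iN1.
    have a1 : ~~ same S1 a p.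
      by apply: contra ap; apply: toggle_refine.
    by rewrite lx // touched_w1 // same_sym (negPf (far_off_disk ap)).
  have := tx e; rewrite in_toggle eqxx addbT in_setD1 eqxx /cut /=.
  by case: (e \in tag (val x)); case: (e \in S) => // /(_ erefl).
apply/diskP; split; first exact: cut_diff.
move=> c cp; rewrite touched_w1 //; case: ifP => cf.
  rewrite -lf; apply: label_same; rewrite same_sym.
  by rewrite (far_orbit _ (cut_diff tx cx)) same_sym.
apply: lx; apply/negP => /S_split; by rewrite cf (negPf cp).
Qed.

Let build_cut x t : x \in D -> ~~ cut (tag (val x)) -> exists2 y, y \in D &
  [/\ tag (val y) = toggle (tag (val x)) e,
      forall c, ~~ same S1 far c -> label (val y) c = label (val x) c &
      label (val y) far = t].
Proof.
move=> /diskP[tx lx] ux; set T := toggle (tag (val x)) e.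
have cT : cut T by rewrite cut_toggle.
have farT := far_orbit _ (cut_diff (toggle_in tx) cT).
pose l c := if same S1 far c then t else label (val x) c.
have lT b c : same T b c -> l b = l c.
  move=> bc; rewrite /l -!farT (same_congr _ bc); case: ifP => // _.
  by apply: label_same; apply: toggle_refine bc; apply: uncut_near_far.
have yp : ~~ label (mkgen T l) p.
  by rewrite label_mkgen // /l (negPf far_p) (valP x).
exists (Sub (mkgen T l) yp : rkh_gen p).
  apply/diskP; rewrite /=; split=> [|a ap]; first exact: toggle_in.
  by rewrite label_mkgen // /l (negPf (far_off_disk ap)) lx.
split=> //= [c cf|]; rewrite label_mkgen // /l; first by rewrite (negPf cf).
by rewrite same_refl.
Qed.

Let build_uncut x : x \in D -> cut (tag (val x)) -> exists2 y, y \in D &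
  tag (val y) = toggle (tag (val x)) e /\
  forall c, ~~ same S1 far c -> label (val y) c = label (val x) c.
Proof.
move=> /diskP[tx lx] cx; set T := toggle (tag (val x)) e.
have uT : ~~ cut T by rewrite cut_toggle negbK.
have TN := toggle_in tx.
have farx := far_orbit _ (cut_diff tx cx).
have Tends := uncut_near_far TN uT.
have Tnf : same T near far by rewrite -ends_near_far.
pose l c := label (val x) (if same S1 far c then near else c).
have l_near c : same T c near -> l c = label (val x) near.
  rewrite /l; case: ifP => // cf cn; apply: label_same.
  have c0 : same T c (end0 G e).
    apply: same_trans cn _; rewrite /near /near_end.
    by case: ifP => _; [exact: same_refl | rewrite same_sym].
  have := toggle_split Tends c0; rewrite toggleK ends_or.
  by rewrite [same _ c far]same_sym farx cf orbF.
have lT b c : same T b c -> l b = l c.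
  move=> bc; have [bn|bn] := boolP (same T b near).
    by rewrite !l_near // -(same_congl _ bc).
  have off d : same T b d -> ~~ same S1 far d.
    move=> bd; apply: contra bn => fd; rewrite (same_congr _ Tnf).
    apply: same_trans bd _; rewrite same_sym.
    by apply: (toggle_coarsen (cut_near_far tx cx)); rewrite farx.
  have /norP[b0 b1] : ~~ (same T b (end0 G e) || same T b (end1 G e)).
    by rewrite ends_or -(same_congr _ Tnf) orbb.
  rewrite /l (negPf (off b _)) ?same_refl // (negPf (off c bc)).
  by apply: label_same; rewrite -(toggleK (tag (val x)) e) toggle_off.
have yp : ~~ label (mkgen T l) p.
  by rewrite label_mkgen // /l (negPf far_p) (valP x).
exists (Sub (mkgen T l) yp : rkh_gen p).
  apply/diskP; rewrite /=; split=> // a ap.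
  by rewrite label_mkgen // /l (negPf (far_off_disk ap)) lx.
by split=> //= c cf; rewrite label_mkgen // /l (negPf cf).
Qed.

Let disk_eq x y : x \in D -> y \in D -> tag (val x) = tag (val y) ->
  (forall c, ~~ same S1 far c -> label (val x) c = label (val y) c) ->
  (cut (tag (val x)) -> label (val x) far = label (val y) far) -> x = y.
Proof.
move=> /diskP[tx lx] /diskP[ty ly] xy off onf.
apply: val_inj; apply: kh_gen_ext => // c.
have [fc|] := boolP (same S1 far c); last exact: off.
have [cx|ux] := boolP (cut (tag (val x))).
  have xc : same (tag (val x)) far c by rewrite (far_orbit _ (cut_diff tx cx)).
  by rewrite -(label_same xc) onf //; apply: label_same; rewrite -xy.
have cx : cut (toggle (tag (val x)) e) by rewrite cut_toggle.
have xe := uncut_near_far tx ux.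
have fcx : same (tag (val x)) far c.
  apply: (toggle_refine xe).
  by rewrite (far_orbit _ (cut_diff (toggle_in tx) cx)).
have ncx : same (tag (val x)) near c.
  by rewrite -(same_congr _ fcx) -ends_near_far.
rewrite -(label_same ncx) off 1?same_sym //.
by apply: label_same; rewrite -xy.
Qed.

Let label_far_stable x y : x \in D -> y \in D ->
  cut (tag (val x)) -> cut (tag (val y)) ->
  kh_coef (val x) (val y) != 0 -> label (val x) far = label (val y) far.
Proof.
move=> /diskP[tx _] /diskP[ty _] cx cy /kh_coef_neq0[f exy [fx yE]].
apply: (edge_coef_away exy); apply: (away_far (cut_diff tx cx)).
rewrite in_setD1; apply/andP; split.
  apply: contraTneq cx => fe; move: cy fx.
  by rewrite /cut yE fe setU11; case: (e \in S); case: (e \in tag (val x)).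
have := ty f; have := tx f; rewrite yE setU11 (negPf fx).
by case: (f \in S) => [H _|_ H]; apply: H.
Qed.

Let far_sub T c : (forall i, (i \in T) != (i \in S) -> i \in N) ->
  same S1 far c -> same T far c.
Proof.
move=> TN fc; have [cT|uT] := boolP (cut T).
  by rewrite (far_orbit _ (cut_diff TN cT)).
apply: (toggle_refine (uncut_near_far TN uT)).
by rewrite (far_orbit _ (cut_diff (toggle_in TN) _)) // cut_toggle.
Qed.

Let same_near T c : (forall i, (i \in T) != (i \in S) -> i \in N) ->
  ~~ same S1 far c -> same T c (end0 G e) || same T c (end1 G e) ->
  same T c near.
Proof.
move=> TN fc; rewrite ends_or => /orP[//|cf].
have [cT|uT] := boolP (cut T).
  by rewrite same_sym (far_orbit _ (cut_diff TN cT)) (negPf fc) in cf.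
rewrite (same_congr _ (_ : same T near far)) //.
by rewrite -ends_near_far uncut_near_far.
Qed.

(** The pairs that cancel: [y] is obtained from [x] by adding [e], with the
    same labels off the far circle. If [e] is cut in [x], the far label is v_+
    and the merge is the multiplication by v_+; if [e] is cut in [y], it is
    v_- and the term is the component of Delta with v_- on the far side. Both
    are the identity on the near label. *)
Let matched : rel (rkh_gen p) := fun x y =>
  (tag (val y) == e |: tag (val x)) &&
  [forall c, ~~ same S1 far c ==> (label (val x) c == label (val y) c)].

Let matched_away x y : x \in D -> y \in D -> e \notin tag (val x) ->
  tag (val y) = e |: tag (val x) ->
  [forall c, ~~ same S1 far c ==> (label (val x) c == label (val y) c)] =
  [forall c, away (tag (val x)) e c ==> (label (val x) c == label (val y) c)] &&
  (label (val x) near == label (val y) near).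
Proof.
move=> /diskP[tx _] /diskP[ty _] ex; rewrite -toggle_add // => yE.
apply/forallP/andP => [xy|[/forallP xy /eqP xyn] c].
  split; last by move/implyP: (xy near); apply; rewrite same_sym.
  apply/forallP => c; apply/implyP => ac; move/implyP: (xy c); apply.
  apply: contraL ac => /(far_sub tx) fc.
  by rewrite /away -negb_or ends_or negbK [same _ c far]same_sym fc orbT.
apply/implyP => fc; have [ac|] := boolP (away (tag (val x)) e c).
  by move/implyP: (xy c); apply.
rewrite /away -negb_or negbK => xc; have yc : same (tag (val y)) c near.
  apply: same_near => //; rewrite yE.
  have [xe|xe] := boolP (same (tag (val x)) (end0 G e) (end1 G e)).
    apply: toggle_split => //; case/orP: xc => // c1.
    by rewrite (same_congr _ xe).
  by case/orP: xc => /(toggle_coarsen xe)->; rewrite ?orbT.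
by rewrite (label_same (same_near tx fc xc)) xyn (label_same yc).
Qed.

Let kh_coef_matched x y : x \in D -> y \in D ->
  e \notin tag (val x) -> e \in tag (val y) ->
  (cut (tag (val x)) -> label (val x) far) ->
  (cut (tag (val y)) -> ~~ label (val y) far) ->
  kh_coef (val x) (val y) =
    if matched x y then edge_sign e (tag (val x)) else 0.
Proof.
move=> xD yD ex ey lx ly; rewrite kh_coefE (bigD1 e) //= big1 ?addr0 => [|f fe].
  rewrite /edge_coef ex /matched /=; case: eqP => yE; last by rewrite mulr0.
  rewrite (matched_away xD yD ex yE) /dxi_coef /= -same_bdry.
  set W := [forall a, _ ==> _].
  have -> : W = [forall c, away (tag (val x)) e c ==>
                  (label (val x) c == label (val y) c)].
    by apply: eq_forallb => c; rewrite /= -!same_bdry.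
  case: [forall c, _] => /=; last by rewrite mulr0.
  rewrite -/(end0 G e) -/(end1 G e).
  suff -> : (if ~~ same (tag (val x)) (end0 G e) (end1 G e)
      then m_coef (label (val x) (end0 G e)) (label (val x) (end1 G e))
             (label (val y) (end0 G e))
      else Delta_coef (label (val x) (end0 G e)) (label (val y) (end0 G e))
             (label (val y) (end1 G e))) =
    (label (val x) near == label (val y) near)%:R.
    by case: (_ == _); rewrite ?mulr1 ?mulr0.
  have yE' : tag (val y) = toggle (tag (val x)) e by rewrite toggle_add.
  have cxy : cut (tag (val y)) = ~~ cut (tag (val x)) by rewrite yE' cut_toggle.
  have /diskP[tx _] := xD; have /diskP[ty _] := yD.
  have [cx|ux] := boolP (cut (tag (val x))).
    have uy : ~~ cut (tag (val y)) by rewrite cxy cx.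
    rewrite (cut_near_far tx cx) /= (label_same (uncut_near_far ty uy)).
    have := lx cx; rewrite /near /far /near_end /far_end; case: ifP => _ -> //.
      rewrite (label_same (uncut_near_far ty uy)).
      by case: (label _ _); case: (label _ _).
    by case: (label _ _); case: (label _ _).
  have cy : cut (tag (val y)) by rewrite cxy ux.
  rewrite (uncut_near_far tx ux) /=.
  have := ly cy; rewrite /near /far /near_end /far_end; case: ifP => _ /negPf->.
    by case: (label _ _); case: (label _ _).
  rewrite (label_same (uncut_near_far tx ux)).
  by case: (label _ _); case: (label _ _).
rewrite /edge_coef; case: ifP => [/andP[_ /eqP yE]|]; last by rewrite mulr0.
by move: ey; rewrite yE in_setU1 (negPf ex) orbF eq_sym (negPf fe).
Qed.

Let Xs : {set rkh_gen p} := [set x in D |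
  (e \notin tag (val x)) && (cut (tag (val x)) ==> label (val x) far)].
Let Ys : {set rkh_gen p} := [set y in D |
  (e \in tag (val y)) && (cut (tag (val y)) ==> ~~ label (val y) far)].

Let collapsible_matched : collapsible (C := rCKh p) (Xs :|: Ys) set0.
Proof.
apply: (@collapsible_pair (rCKh p) Xs Ys matched
  (fun x : rkh_gen p => edge_sign e (tag (val x)))).
- exact: rCKh_is_cochain_complex.
- rewrite -setI_eq0; apply/eqP/setP => x; rewrite !inE.
  by case: (e \in tag (val x)); rewrite ?andbF.
- by move=> x; rewrite -expr2 sqrr_sign.
- move=> x y; rewrite inE => /and3P[xD ex /implyP lx].
  rewrite inE => /and3P[yD ey /implyP ly].
  exact: kh_coef_matched.
- move=> x; rewrite inE => /and3P[xD ex /implyP lx].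
  have [y yD [yE xy ly]] : exists2 y, y \in D &
      [/\ tag (val y) = toggle (tag (val x)) e,
        forall c, ~~ same S1 far c -> label (val y) c = label (val x) c &
        cut (tag (val y)) -> ~~ label (val y) far].
    have [cx|ux] := boolP (cut (tag (val x))).
      have [y yD [yE xy]] := build_uncut xD cx; exists y => //; split=> //.
      by rewrite yE cut_toggle cx.
    by have [y yD [yE xy ly]] := build_cut false xD ux; exists y; rewrite ?ly.
  exists y.
    by rewrite inE yD yE in_toggle eqxx addbT ex /= -yE; apply/implyP.
  rewrite /matched yE toggle_add // eqxx.
  by apply/forallP => c; apply/implyP => /xy->.
- move=> y; rewrite inE => /and3P[yD ey /implyP ly].
  have [x xD [xE xy lx]] : exists2 x, x \in D &
      [/\ tag (val x) = toggle (tag (val y)) e,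
        forall c, ~~ same S1 far c -> label (val x) c = label (val y) c &
        cut (tag (val x)) -> label (val x) far].
    have [cy|uy] := boolP (cut (tag (val y))).
      have [x xD [xE xy]] := build_uncut yD cy; exists x => //; split=> //.
      by rewrite xE cut_toggle cy.
    by have [x xD [xE xy lx]] := build_cut true yD uy; exists x; rewrite ?lx.
  have ex : e \notin tag (val x) by rewrite xE in_toggle eqxx ey.
  exists x; first by rewrite inE xD ex /=; apply/implyP.
  rewrite /matched -toggle_add // xE toggleK eqxx.
  by apply/forallP => c; apply/implyP => /xy->.
- move=> x y y' _; rewrite inE => /and3P[yD _ /implyP ly].
  rewrite inE => /and3P[yD' _ /implyP ly'].
  move=> /andP[/eqP yE /forallP xy] /andP[/eqP yE' /forallP xy'].
  apply: disk_eq => // [|c fc|cy]; first by rewrite yE.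
    by have /implyP/(_ fc)/eqP<- := xy c; have /implyP/(_ fc)/eqP<- := xy' c.
  by rewrite (negPf (ly cy)); rewrite yE -yE' in cy; rewrite (negPf (ly' cy)).
- move=> x x' y; rewrite inE => /and3P[xD ex /implyP lx].
  rewrite inE => /and3P[xD' ex' /implyP lx'] _.
  move=> /andP[/eqP yE /forallP xy] /andP[/eqP yE' /forallP xy'].
  have xx' : tag (val x) = tag (val x').
    by rewrite -[LHS](setU1K ex) -yE yE' setU1K.
  apply: disk_eq => // [c fc|cx].
    by have /implyP/(_ fc)/eqP-> := xy c; have /implyP/(_ fc)/eqP-> := xy' c.
  by rewrite lx // lx' // -xx'.
Qed.

(** The differential goes only one way between the cancelling generators and
    the surviving ones, because it can change the far label only by toggling
    [e]; the way depends on whether [e] is added or removed. *)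
Lemma collapsible_peel (Z : {set rkh_gen p}) :
  collapsible (C := rCKh p) (disk S1 N1 w1) Z -> collapsible (C := rCKh p) D Z.
Proof.
move=> cZ; have Cc := rCKh_is_cochain_complex.
have DE : D = (Xs :|: Ys) :|: disk S1 N1 w1.
  apply/setP => x; rewrite !in_setU peel_disk [x \in Xs]in_set [x \in Ys]in_set.
  case: (x \in D) => //=; rewrite /cut.
  by case: (e \in tag (val x)); case: (e \in S); case: (label (val x) far).
have dis : [disjoint Xs :|: Ys & disk S1 N1 w1].
  rewrite -setI_eq0; apply/eqP/setP => x; rewrite in_setI in_set0 in_setU.
  rewrite peel_disk [x \in Xs]in_set [x \in Ys]in_set.
  case: (x \in D) => //=; rewrite /cut.
  by case: (e \in tag (val x)); case: (e \in S); case: (label (val x) far).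
rewrite DE; have [eS|eS] := boolP (e \in S).
  rewrite setUC -[Z]setU0; apply: collapsible_glue => //.
    by rewrite disjoint_sym.
  move=> x y xXY; rewrite peel_disk eS => /and3P[yD cy /eqP ly].
  apply/eqP; apply: contraT => xy0.
  have [f _ [_ yE]] := kh_coef_neq0 xy0.
  have ex : e \notin tag (val x).
    have : e \notin tag (val y).
      by move: cy; rewrite /cut eS; case: (e \in tag (val y)).
    by rewrite yE in_setU1 negb_or => /andP[].
  move: xXY; rewrite in_setU [x \in Xs]in_set [x \in Ys]in_set (negPf ex) /=.
  rewrite andbF orbF => /andP[xD].
  have cx : cut (tag (val x)) by rewrite /cut eS (negPf ex).
  by rewrite cx (label_far_stable xD yD cx cy xy0) ly.
rewrite -[Z]set0U; apply: collapsible_glue => // x y.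
rewrite peel_disk eS => /and3P[xD cx /eqP lx] yXY.
apply/eqP; apply: contraT => xy0.
have [f _ [_ yE]] := kh_coef_neq0 xy0.
have ey : e \in tag (val y).
  move: cx; rewrite yE in_setU1 /cut (negPf eS).
  by case: (e \in tag (val x)); rewrite ?orbT.
move: yXY; rewrite in_setU [y \in Xs]in_set [y \in Ys]in_set ey /= andbF /=.
move=> /andP[yD].
have cy : cut (tag (val y)) by rewrite /cut (negPf eS) ey.
by rewrite cy -(label_far_stable xD yD cx cy xy0) lx.
Qed.

Lemma peel_mem : p \in w1.
Proof. by rewrite /w1 /peel_word; case: ifP; rewrite // in_cons pw orbT. Qed.

Lemma peel_indep : indep S1 w1.
Proof.
have := indep_merge w S1ends; rewrite toggleK Sw => /esym/andP[S1w _].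
rewrite /w1 /peel_word; case: ifP => // eS; rewrite indep_cons S1w andbT.
apply/hasPn => d dw; apply: contra far_p => fd.
have dp : same S d p.
  by apply: same_trans S_far_p; rewrite same_sym; apply: (toggle_refine Sends).
by rewrite -(indep_inj Sw dw pw dp).
Qed.

Lemma peel_qdeg : kh_qdeg (word_gen S1 w1) =
  kh_qdeg (word_gen S w) + (if e \in S then - 2 else 2).
Proof.
rewrite (kh_qdeg_word_gen peel_indep) (kh_qdeg_word_gen Sw) /w1 /peel_word.
have := nb_toggle G S e; rewrite Sends addn0 => ->.
rewrite /S1; case: ifP => eS.
  by rewrite toggle_remove // (cardsD1 e S) eS /= add1n !intS; ring.
by rewrite toggle_add ?eS // cardsU1 eS /= add1n !intS; ring.
Qed.

(** The far circle is a component whether or not another chord [f] is toggled,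
    so splitting it off does not separate ends on the near side. *)
Lemma peel_nocross :
  {in N &, forall f g, f != g -> same (toggle S f) (end0 G g) (end1 G g)} ->
  {in N1 &, forall f g, f != g -> same (toggle S1 f) (end0 G g) (end1 G g)}.
Proof.
move=> nocross f g fN1 gN1 fg.
have /andP[fe fN] : (f != e) && (f \in N) by rewrite -in_setD1.
have /andP[ge gN] : (g != e) && (g \in N) by rewrite -in_setD1.
have Sf_e : same (toggle S f) (end0 G e) (end1 G e) by apply: nocross.
have Sf_g : same (toggle S f) (end0 G g) (end1 G g) by apply: nocross.
rewrite /S1 toggleC; set T := toggle (toggle S f) e.
have TS1 i : (i \in T) != (i \in S1) -> i \in N1.
  rewrite /T /S1 toggleC in_toggle; have [->|_] := eqVneq i f; first by [].
  by rewrite addbF eqxx.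
have [g0 g1] := away_e gN ge.
have gfar c : same S1 c p -> ~~ same T c far.
  by move=> cp; rewrite same_sym far_orbit // (same_congr _ cp) far_p.
have [|g_off] := boolP (same (toggle S f) (end0 G g) (end0 G e)
                     || same (toggle S f) (end0 G g) (end1 G e)).
  have near_of c : same S1 c p -> same (toggle S f) c (end0 G e) ->
      same T c near.
    move=> cp ce; have := toggle_split Sf_e ce.
    by rewrite ends_or (negPf (gfar c cp)) orbF.
  rewrite -(same_congr _ Sf_e) orbb => ge0.
  rewrite (same_congl _ (near_of _ g0 ge0)) same_sym near_of //.
  by rewrite -(same_congl _ Sf_g).
by move: g_off => /norP[? ?]; rewrite toggle_off.
Qed.


End Peel.

(** Peeling all the chords leaves the generator with every edge of [N]
    toggled. An added edge brings a circle labelled v_+, hence degree (1, 2),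
    and a removed one a circle labelled v_-, hence degree (-1, -2). *)
Lemma collapsible_disk N S w : indep S w -> p \in w ->
  {in N, forall f, same S (end0 G f) p /\ same S (end1 G f) p} ->
  {in N &, forall f g, f != g -> same (toggle S f) (end0 G g) (end1 G g)} ->
  exists z : rkh_gen p, [/\ collapsible (C := rCKh p) (disk S N w) [set z],
    tag (val z) = [set i | (i \in S) (+) (i \in N)] &
    kh_qdeg (val z) = kh_qdeg (word_gen S w)
      + (#|N :\: S|%:Z - #|N :&: S|%:Z) *+ 2].
Proof.
have [m] := ubnP #|N|; elim: m => // m IHm in S N w *.
rewrite ltnS => Nm Sw pw inp nocross.
have [N0|Nn0] := eqVneq N set0.
  have xp : ~~ label (word_gen S w) p.
    by rewrite label_word_gen negbK; apply/hasP; exists p; rewrite ?same_refl.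
  pose z : rkh_gen p := Sub (word_gen S w) xp.
  exists z; rewrite N0; split=> /=.
  - rewrite (_ : disk S set0 w = [set z]); first exact: collapsible_id.
    apply/setP => x; rewrite in_set1.
    apply/diskP/eqP => [[tx lx]|->]; last first.
      by split=> [i|a _] /=; rewrite ?eqxx // label_word_gen.
    have txS : tag (val x) = S.
      apply/setP => i; have := tx i; rewrite inE.
      by case: (_ \in _); case: (_ \in _) => // /(_ erefl).
    apply: val_inj; apply: (@kh_gen_ext _ _ (val x) (word_gen S w) txS) => a.
    rewrite label_word_gen; have [ap|/lx//] := boolP (same S a p).
    rewrite (label_same (b := p)) ?txS // (negPf (valP x)); apply/esym/negbTE.
    by rewrite negbK; apply/hasP; exists p.
  - by apply/setP => i; rewrite !inE addbF.
  - by rewrite set0D set0I cards0 subrr mul0rn addr0.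
have [e eN away_e] := innermost Nn0 inp nocross.
have eN1 : #|N| = #|N :\ e|.+1 by rewrite (cardsD1 e) eN.
have [|||||z [cz tz qz]] := IHm (toggle S e) (N :\ e)
  (peel_word S e w).
- by rewrite -eN1.
- exact: peel_indep eN Sw pw inp.
- exact: (peel_mem S e pw).
- by move=> f; rewrite in_setD1 => /andP[fe fN]; apply: away_e.
- exact: (peel_nocross eN inp away_e nocross).
exists z; split; first exact: (collapsible_peel eN Sw pw inp away_e cz).
  rewrite tz; apply/setP => i; rewrite !inE.
  by case: eqVneq => [->|]; rewrite ?eN ?addbF ?addbT.
rewrite qz (peel_qdeg eN Sw pw inp).
have [eS|eS] := boolP (e \in S).
  rewrite toggle_remove //.
  have -> : (N :\ e) :\: (S :\ e) = N :\: S.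
    by apply/setP => i; rewrite !inE; case: eqVneq => // ->; rewrite eS.
  have -> : (N :\ e) :&: (S :\ e) = (N :&: S) :\ e.
    by apply/setP => i; rewrite !inE; case: eqVneq.
  by rewrite [#|N :&: S|](cardsD1 e) inE eN eS add1n !intS; ring.
rewrite toggle_add //.
have -> : (N :\ e) :\: (e |: S) = (N :\: S) :\ e.
  by apply/setP => i; rewrite !inE; case: eqVneq => //=; rewrite ?andbF.
have -> : (N :\ e) :&: (e |: S) = N :&: S.
  apply/setP => i; rewrite !inE.
  by case: eqVneq => //= ->; rewrite (negPf eS) andbF.
by rewrite [#|N :\: S|](cardsD1 e) inE eN eS add1n !intS; ring.
Qed.

End Reduced.

(** * Chord diagrams and activities *)

Section Activities.
Variables (n : nat) (G : ribbon_graph n).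
Implicit Types (S T : {set 'I_n}) (e f i j : 'I_n) (a b c : disk_arc G).

Lemma quasi_tree_nb T : is_quasi_tree G T = (nb G T == 1%N).
Proof. by []. Qed.

Lemma quasi_tree_same T a b : is_quasi_tree G T -> same T a b.
Proof.
rewrite quasi_tree_nb /nb => /eqP T1; rewrite same_bdry; apply/eqP.
by have /card_le1_eqP := eq_leq T1; apply.
Qed.

Lemma same_quasi_tree T a : (forall b c, same T b c) -> is_quasi_tree G T.
Proof.
move=> Ts; rewrite quasi_tree_nb eqn_leq /nb; apply/andP; split; last first.
  by apply/card_gt0P; exists (bdry_at T a).
apply/card_le1_eqP => k l _ _; have [b /eqP<-] := bdry_at_surj k.
by have [c /eqP<-] := bdry_at_surj l; apply/eqP; rewrite -same_bdry.
Qed.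

Lemma quasi_tree_toggle2 T i j : is_quasi_tree G T ->
  is_quasi_tree G (toggle (toggle T i) j) =
    ~~ same (toggle T i) (end0 G j) (end1 G j).
Proof.
move=> qT; have := nb_toggle G T i; have := nb_toggle G (toggle T i) j.
rewrite (quasi_tree_same _ _ qT) addn0.
move: qT; rewrite !quasi_tree_nb => /eqP->.
move=> + nbi; rewrite nbi.
by case: (same _ _ _) => /=; case: (nb G _) => [|[|k]] //; lia.
Qed.

Lemma iter_next_half T k h :
  iter k (next_arc T) (inl h : disk_arc G) = inl (iter k (next_half G T) h).
Proof. by elim: k => //= k ->. Qed.

Lemma quasi_tree_fconnect T h h' :
  is_quasi_tree G T -> fconnect (next_half G T) h h'.
Proof.
move=> qT; have /same_iterP[k] := quasi_tree_same (inl h) (inl h') qT.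
by rewrite iter_next_half => -[->]; apply: fconnect_iter.
Qed.

(** Toggling [i] does not change the walk along the boundary between two
    visits to the ends of [i]. *)
Lemma toggle_walk T i (h : half_edge n) k m : (k < m)%N ->
  next_arc (toggle T i) (inl h : disk_arc G) =
    iter k.+1 (next_arc T) (end0 G i) ->
  (forall l, (k < l < m)%N -> (iter l (next_half G T) (i, false)).1 != i) ->
  same (toggle T i) (iter m (next_arc T) (end0 G i)) (inl h).
Proof.
move=> km start off; rewrite same_sym; apply/same_iterP; exists (m - k)%N.
rewrite -(subnSK km) iterSr start.
rewrite (@iter_next_off _ _ T) => [|l h' lm]; first by rewrite -iterD subnK.
rewrite -iterD iter_next_half => -[<-]; rewrite in_toggle.
have /negPf-> : (iter (l + k.+1) (next_half G T) (i, false)).1 != i.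
  by apply: off; lia.
by rewrite addbF.
Qed.

(** The chord of [i] cuts the boundary circle of [T] into the two boundary
    components of [toggle T i], so being on one side of the chord is being on
    the component of one end of [i]. *)
Lemma chord_side T i (h : half_edge n) : is_quasi_tree G T -> h.1 != i ->
  (findex (next_half G T) (i, false) h <
     findex (next_half G T) (i, false) (i, true))%N =
  same (toggle T i) (inl h) (end1 G i).
Proof.
move=> qT hi; set s := next_half G T; set x := (i, false); set y := (i, true).
have xc h' : fconnect s x h' by apply: quasi_tree_fconnect.
have off l : (l < fingraph.order s x)%N -> l != 0%N -> l != findex s x y ->
    (iter l s x).1 != i.
  move=> lo l0 ly; apply/eqP => li.
  have : iter l s x = x \/ iter l s x = y.
    by rewrite /x /y; move: li; case: (iter l s x) => i' [] /= ->; auto.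
  case=> E; first by move: l0; rewrite -(findex_iter lo) E findex0.
  by move: ly; rewrite -(findex_iter lo) E eqxx.
have hE : inl h = iter (findex s x h) (next_arc T) (end0 G i).
  by rewrite iter_next_half iter_findex.
have ny : findex s x h != findex s x y.
  by apply: contraNneq hi => E; rewrite -(iter_findex (xc h)) E iter_findex.
have n0 : findex s x h != 0%N.
  by rewrite findex_eq0; apply: contraNneq hi => <-.
have ho := findex_max (xc h); have yo := findex_max (xc y).
have edge (h' : half_edge n) : h'.1 = i -> next_arc (toggle T i) (inl h') =
    next_arc T (inl (opp_half h') : disk_arc G).
  move=> h'i; apply: next_arc_edge.
  by rewrite in_toggle h'i eqxx; case: (_ \in _).
apply/idP/idP => [hy | ].
  rewrite hE; apply: (@toggle_walk _ _ _ 0); rewrite ?lt0n //.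
    by rewrite edge.
  by move=> l /andP[l0 lh]; apply: off; lia.
apply: contraLR; rewrite -leqNgt => yh.
suff h0 : same (toggle T i) (inl h) (end0 G i).
  by rewrite (same_congl _ h0) same_toggle_ends (quasi_tree_same _ _ qT).
rewrite hE; apply: (@toggle_walk _ _ _ (findex s x y)); first by lia.
  by rewrite edge // iterS iter_next_half iter_findex.
by move=> l /andP[l0 lh]; apply: off; lia.
Qed.

Lemma chords_crossE T i j : is_quasi_tree G T -> j != i ->
  chords_cross G T i j = ~~ same (toggle T i) (end0 G j) (end1 G j).
Proof.
move=> qT ji; rewrite /chords_cross !chord_side //.
have Tends : same T (end0 G i) (end1 G i) by apply: quasi_tree_same.
have split a : same (toggle T i) a (end0 G i) || same (toggle T i) a (end1 G i).
  by apply: toggle_split; rewrite ?quasi_tree_same.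
have nends : ~~ same (toggle T i) (end0 G i) (end1 G i).
  by rewrite same_toggle_ends Tends.
have [j1|j1] := boolP (same _ (inl (j, false)) _).
  by rewrite (same_congl _ j1) [RHS]/= same_sym; case: (same _ _ _).
have := split (inl (j, false)); rewrite (negPf j1) orbF => j0.
rewrite addFb (same_congl _ j0); apply/idP/idP => [j'1|].
  by rewrite same_sym (same_congl _ j'1) same_sym.
have := split (end1 G j); rewrite same_sym => /orP[->//|].
by rewrite /end1.
Qed.

Lemma activeP T i : is_quasi_tree G T ->
  reflect (forall j, (j < i)%N -> same (toggle T i) (end0 G j) (end1 G j))
          (active G T i).
Proof.
move=> qT; apply: (iffP forallP) => act j.
  move=> ji; have /implyP/(_ ji) := act j.
  by rewrite chords_crossE ?negbK //; apply: contraTneq ji => ->; rewrite ltnn.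
apply/implyP => ji; rewrite chords_crossE ?negbK ?act //.
by apply: contraTneq ji => ->; rewrite ltnn.
Qed.

(** The lower edges do not cross the chord of [i], so no change to them
    reconnects the two components that toggling [i] produces. *)
Lemma active_fixed S T i : is_quasi_tree G T -> is_quasi_tree G S ->
  active G T i -> (forall j, (i < j)%N -> (j \in S) = (j \in T)) ->
  (i \in S) = (i \in T).
Proof.
move=> qT qS /(activeP _ qT) act ST; apply/eqP; apply: contraT => iST.
have := same_toggle_ends G T i.
rewrite (quasi_tree_same (T := T)) // => /negP[].
apply: (@same_coarsen _ _ S); last exact: quasi_tree_same.
move=> [j x] /=; rewrite in_toggle.
case: (ltngtP j i) => [ji _ | ij | /val_inj->].
- have := act j ji; rewrite /opp_half; case: x => //=.
  by rewrite same_sym.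
- rewrite ST // (negPf (_ : j != i)) ?addbF ?eqxx //.
  by apply: contraTneq ij => ->; rewrite ltnn.
- by rewrite eqxx addbT; move: iST; case: (_ \in S); case: (_ \in T).
Qed.

(** If a lower chord crossed that of [i] in [S], toggling both edges would
    give a quasi-tree that differs from [T] at [i]. *)
Lemma active_above S T i : is_quasi_tree G T -> is_quasi_tree G S ->
  (forall j, (i < j)%N -> (j \in S) = (j \in T)) ->
  active G T i -> active G S i.
Proof.
move=> qT qS ST act; apply/activeP => // j ji.
apply: contraT; rewrite -quasi_tree_toggle2 // => qS'.
have iS : (i \in S) = (i \in T) := active_fixed qT qS act ST.
have ij : (i == j) = false by apply: contraTF ji => /eqP->; rewrite ltnn.
have : (i \in toggle (toggle S i) j) = (i \in T).
  apply: (active_fixed qT qS' act) => k ik; rewrite !in_toggle ST //.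
  have -> : (k == i) = false by apply: contraTF ik => /eqP->; rewrite ltnn.
  have -> : (k == j) = false.
    by apply: contraTF ik => /eqP->; rewrite ltnNge ltnW.
  by rewrite !addbF.
by rewrite !in_toggle eqxx ij iS; case: (_ \in _).
Qed.

End Activities.

(** * Existence and genus of quasi-trees *)

Section Degrees.
Variables (n : nat) (G : ribbon_graph n).
Implicit Types (S T : {set 'I_n}) (e f i j : 'I_n) (a b c : disk_arc G).

Definition arc_vertex a : vertex G :=
  match a with inl h => base G h | inr v => val v end.

Lemma arc_vertex_surj v : exists a, arc_vertex a == v.
Proof.
have [vi|] := boolP (isolated v); first by exists (inr (Sub v vi)) => /=.
by rewrite negb_forall => /existsP[h]; rewrite negbK => hv; exists (inl h).
Qed.

Lemma base_rotation h : base G (rotation G h) = base G h.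
Proof. by apply/esym/eqP; rewrite -rot_star (mem_porbit _ 1). Qed.

Lemma arc_vertex_next0 a : arc_vertex (next_arc set0 a) = arc_vertex a.
Proof. by case: a => //= h; rewrite /next_half inE base_rotation. Qed.

Lemma same_set0 a b : same set0 a b = (arc_vertex a == arc_vertex b).
Proof.
apply/idP/eqP => [/same_iterP[k ->]|].
  by elim: k => //= k ->; rewrite arc_vertex_next0.
case: a b => [h|v] [h'|v'] /=.
- move=> /eqP; rewrite -rot_star => /porbitP[k ->].
  apply/same_iterP; exists k; rewrite permX; elim: k => //= k <-.
  by rewrite /= /next_half inE.
- by move=> hv; have /forallP/(_ h) := valP v'; rewrite hv eqxx.
- by move=> hv; have /forallP/(_ h') := valP v; rewrite -hv eqxx.
- by move=> /val_inj->; apply: same_refl.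
Qed.

Lemma nb_set0 : nb G set0 = #|vertex G|.
Proof.
pose rep v := xchoose (arc_vertex_surj v).
have repE v : arc_vertex (rep v) = v.
  exact/eqP/(xchooseP (arc_vertex_surj v)).
have rep_inj : injective (fun v => bdry_at set0 (rep v)).
  by move=> v w /eqP; rewrite -same_bdry same_set0 !repE => /eqP.
rewrite -(card_codom rep_inj); apply: eq_card => k; rewrite [LHS]/= inE.
apply/esym/codomP; have [a /eqP<-] := bdry_at_surj k; exists (arc_vertex a).
by apply/eqP; rewrite -same_bdry same_set0 repE.
Qed.

(** Each edge changes the number of boundary components by one, starting from
    one component for each vertex when there is no edge. *)
Lemma nb_parity S : exists k, (nb G S + #|S| = #|vertex G| + k.*2)%N.
Proof.
have [m] := ubnP #|S|; elim: m => // m IHm in S *; rewrite ltnS => Sm.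
have [->|/set0Pn[e eS]] := eqVneq S set0.
  by exists 0%N; rewrite cards0 nb_set0.
have Se : #|S| = #|toggle S e|.+1 by rewrite toggle_remove // (cardsD1 e) eS.
have [|k nbk] := IHm (toggle S e); first by rewrite -Se.
have := nb_toggle G (toggle S e) e; rewrite toggleK Se.
case: (same _ _ _) => /=; rewrite ?addn0 ?addn2.
  by move=> ->; exists k.+1; rewrite addSn addnS nbk doubleS !addnS.
by move=> [nbS]; exists k; rewrite addnS -addSn nbS.
Qed.

Lemma adjacent_sym S : symmetric (@adjacent n G S).
Proof.
move=> v w; apply/existsP/existsP => -[h /and3P[hS /eqP<- /eqP<-]];
  exists (opp_half h); rewrite /opp_half /= negbK hS eqxx /=;
  by case: h hS => i b.
Qed.

Lemma connect_next S a :
  connect (@adjacent n G S) (arc_vertex a) (arc_vertex (next_arc S a)).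
Proof.
case: a => [h|v] /=; last exact: connect0.
rewrite /next_half base_rotation; case: ifP => hS; last exact: connect0.
by apply/connect1/existsP; exists h; rewrite hS !eqxx.
Qed.

Lemma quasi_tree_connect T v w :
  is_quasi_tree G T -> connect (@adjacent n G T) v w.
Proof.
move=> qT; have [a /eqP<-] := arc_vertex_surj v.
have [b /eqP<-] := arc_vertex_surj w.
have /same_iterP[k ->] := quasi_tree_same a b qT.
elim: k => [|k IHk]; first exact: connect0.
exact: connect_trans IHk (connect_next _ _).
Qed.

Lemma quasi_tree_genus T : is_quasi_tree G T ->
  (#|T| + 1 = #|vertex G| + (genus G T).*2)%N.
Proof.
move=> qT; rewrite /genus.
have /card_gt0P[v _] := vertex_gt0 G.
have -> : n_comp (@adjacent n G T) predT = 1%N.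
  have csym : connect_sym (@adjacent n G T).
    by apply/sym_connect_sym/adjacent_sym.
  rewrite -(n_comp_connect csym v); apply: eq_n_comp_r => w.
  by rewrite [RHS]quasi_tree_connect.
have [k] := nb_parity T.
move: (qT); rewrite quasi_tree_nb -/(nb G T) => /eqP-> nbk.
have -> : (2 * 1 + #|T| - (#|vertex G| + 1) = k.*2)%N by lia.
by rewrite doubleK; lia.
Qed.

(** A set of edges with the fewest boundary components has both ends of every
    edge on the same component, since toggling the edge would otherwise merge
    two of them. So the component of an arc is invariant under the rotation
    and under passing to the opposite half-edge, and connectedness leaves only
    one. *)
Lemma exists_quasi_tree : connected_graph G -> exists T, is_quasi_tree G T.
Proof.
move=> conn.
have [T _ Tmin] := @arg_minnP _ (set0 : {set 'I_n}) predT (nb G) isT.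
exists T.
have Te e : same T (end0 G e) (end1 G e).
  apply: contraT => /negPf ne; have := nb_toggle G T e; rewrite ne /=.
  by have := Tmin (toggle T e) isT; lia.
have Topp (h : half_edge n) : same T (inl h) (inl (opp_half h) : disk_arc G).
  exact: toggle_ends.
have Trot (h : half_edge n) : same T (inl (rotation G h) : disk_arc G) (inl h).
  have [hT|hT] := boolP (h.1 \in T); last first.
    have := same_next T (inl h : disk_arc G).
    by rewrite /= /next_half (negPf hT).
  have := same_next T (inl (opp_half h) : disk_arc G).
  rewrite /= /next_half /= hT /opp_half /= negbK.
  have -> : (h.1, h.2) = h by case: (h).
  by move=> hr; apply: same_trans hr _; rewrite same_sym; apply: Topp.
have Tbase (h k : half_edge n) : base G h = base G k ->
    same T (inl h : disk_arc G) (inl k).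
  move=> /eqP; rewrite -rot_star => /porbitP[l ->].
  rewrite permX; elim: l => [|l IHl]; first exact: same_refl.
  by apply: same_trans IHl _; rewrite same_sym; apply: Trot.
have /card_gt0P[v0 _] := vertex_gt0 G; have [a _] := arc_vertex_surj v0.
apply: (same_quasi_tree a) => {a} b c.
(* An isolated vertex of a connected graph is its only vertex. *)
have [isov|noiso] := boolP [exists v : vertex G, isolated v].
  have /existsP[v iv] := isov.
  have one w : w = v.
    have /connectP[[|u s] //= /andP[+ _] _] := conn v w.
    case/existsP=> h /and3P[_ /eqP hv _].
    by move/forallP/(_ h): iv; rewrite hv eqxx.
  have nohalf (h : half_edge n) : False.
    by have /forallP/(_ h) := iv; rewrite (one (base G h)) eqxx.
  case: b c => [h|v1] [h'|v2]; do ?[by case: (nohalf h)|by case: (nohalf h')].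
  suff -> : v1 = v2 by apply: same_refl.
  by apply: val_inj; rewrite (one (val v1)) (one (val v2)).
have halves a : exists h : half_edge n, a = inl h.
  case: a => [h|v]; first by exists h.
  by case/existsP: noiso; exists (val v); apply: valP.
have [h ->] := halves b; have [h' ->] := halves c.
have /connectP[s] := conn (base G h) (base G h').
elim: s h => [|u s IHs] h /=; first by move=> _ /esym/Tbase.
case/andP=> /existsP[k /and3P[_ /eqP hk /eqP ku]] us h'E.
apply: same_trans (IHs (opp_half k) _ _); last 2 first.
- by rewrite ku.
- by rewrite ku.
by apply: same_trans (Topp k); apply: Tbase.
Qed.

End Degrees.

(** * Cells of the cube indexed by quasi-trees *)

Section Cells.
Variables (n : nat) (G : ribbon_graph n) (p : disk_arc G).
Implicit Types (S T : {set 'I_n}) (e f i j : 'I_n) (k : nat).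

(** The edge sets that agree with [T] on its inactive edges of index at least
    [k]: the whole cube if [k] is large, and for [k = 0] the family obtained
    from [T] by changing active edges. *)
Definition in_cell k T S : bool :=
  [forall i : 'I_n, (k <= i)%N && ~~ active G T i ==> ((i \in S) == (i \in T))].

Lemma in_cellP k T S : reflect
  (forall i, (k <= i)%N -> ~~ active G T i -> (i \in S) = (i \in T))
  (in_cell k T S).
Proof.
apply: (iffP forallP) => TS i; last by apply/implyP => /andP[ki ai]; rewrite TS.
by move=> ki ai; apply/eqP; move/implyP: (TS i); apply; rewrite ki.
Qed.

Lemma in_cell_refl k T : in_cell k T T.
Proof. exact/in_cellP. Qed.

(** At the largest edge on which two quasi-trees differ, both are inactive, so
    their cells are separated there. *)
Lemma cell_unique S T T' : is_quasi_tree G T -> is_quasi_tree G T' ->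
  in_cell 0 T S -> in_cell 0 T' S -> T = T'.
Proof.
move=> qT qT' /in_cellP ST /in_cellP ST'; apply/eqP; apply: contraT => TT'.
have [i0 Di0] : exists i, (i \in T) != (i \in T').
  apply/existsP; apply: contraNT TT' => /existsPn TT'.
  by apply/eqP/setP => i; have := TT' i; rewrite negbK => /eqP.
have [i Di imax] := @arg_maxnP _ i0 (fun i => (i \in T) != (i \in T')) val Di0.
have above j : (i < j)%N -> (j \in T') = (j \in T).
  by move=> ij; apply/eqP; apply: contraTT ij; rewrite -leqNgt eq_sym => /imax.
have aT : ~~ active G T i.
  by apply: contra Di => aT; rewrite (active_fixed qT qT' aT above).
have aT' : ~~ active G T' i.
  apply: contra Di => aT'; rewrite (active_fixed qT' qT aT') // => j ij.
  by rewrite above.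
by case/negP: Di; rewrite -ST // -ST'.
Qed.

Lemma in_cell_active k T S :
  is_quasi_tree G T -> (forall i, k = i -> active G T i) ->
  in_cell k.+1 T S = in_cell k T S.
Proof.
move=> qT ak; apply/in_cellP/in_cellP => TS i ki ai; apply: TS => //;
  last exact: ltnW.
by rewrite ltn_neqAle ki andbT; apply: contra ai => /eqP; apply: ak.
Qed.

(** Toggling an inactive edge together with a lower one whose chord crosses
    its own gives another quasi-tree. *)
Lemma inactive_pivot T i : is_quasi_tree G T -> ~~ active G T i ->
  exists T', [/\ is_quasi_tree G T', (i \in T') = (i \notin T),
    forall j, (i < j)%N -> (j \in T') = (j \in T) &
    ~~ active G T' i].
Proof.
move=> qT; rewrite negb_forall => /existsP[j].
have [ji|] := boolP (j < i)%N; rewrite //= negbK.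
have ij : (i == j) = false by apply: contraTF ji => /eqP->; rewrite ltnn.
rewrite chords_crossE ?[j == i]eq_sym ?ij // -quasi_tree_toggle2 // => qT'.
have above (l : 'I_n) : (i < l)%N -> (l \in toggle (toggle T i) j) = (l \in T).
  move=> il; rewrite !in_toggle.
  have -> : (l == i) = false by apply: contraTF il => /eqP->; rewrite ltnn.
  have -> : (l == j) = false.
    by apply: contraTF il => /eqP->; rewrite -leqNgt ltnW.
  by rewrite !addbF.
have iT' : (i \in toggle (toggle T i) j) = (i \notin T).
  by rewrite !in_toggle eqxx ij addbF addbT.
exists (toggle (toggle T i) j); split=> //.
apply/negP => aT'.
have := active_fixed qT' qT aT' (fun l il => esym (above l il)).
by rewrite iT'; case: (_ \in _).
Qed.

(** The two quasi-trees have the same active edges above [i], so releasing the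
    inactive edge [i] unites their cells, which [i] itself tells apart. *)
Lemma in_cell_split i T T' S : is_quasi_tree G T -> is_quasi_tree G T' ->
  ~~ active G T i -> ~~ active G T' i -> (i \in T') = (i \notin T) ->
  (forall j, (i < j)%N -> (j \in T') = (j \in T)) ->
  [/\ in_cell i.+1 T S = in_cell i T S || in_cell i T' S,
      in_cell i T S -> (i \in S) = (i \in T) &
      in_cell i T' S -> (i \in S) = (i \notin T)].
Proof.
move=> qT qT' aT aT' iT' above; split; first last.
- by move=> /in_cellP TS; rewrite TS.
- by move=> /in_cellP TS; rewrite TS.
have act j : (i < j)%N -> active G T j = active G T' j.
  move=> ij; apply/idP/idP; apply: active_above => // l jl.
    by rewrite above // (ltn_trans ij).
  by rewrite above // (ltn_trans ij).
apply/in_cellP/orP => [TS|[] /in_cellP TS j ij aj].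
- have [iS|iS] := eqVneq (i \in S) (i \in T); [left | right];
    apply/in_cellP => j; rewrite leq_eqVlt => /orP[/eqP/val_inj<-|ij] aj //.
  + exact: TS.
  + by rewrite iT'; move: iS; case: (_ \in S); case: (_ \in T).
  + by rewrite above // TS // act.
- by apply: TS => //; apply: ltnW.
- by rewrite -above // TS -?act // ltnW.
Qed.

Definition cell k T : {set rkh_gen p} := [set x | in_cell k T (tag (val x))].

(** The chords of the active edges do not cross, so the cell of a quasi-tree
    collapses to the generator with all of them toggled. *)
Lemma exists_critical (T : quasi_tree G) : exists z : rkh_gen p,
  [/\ collapsible (C := rCKh p) (cell 0 (val T)) [set z],
      in_cell 0 (val T) (tag (val z)) &
      kh_hdeg (val z) = qt_hdeg T /\ kh_qdeg (val z) + 1 = qt_qdeg T].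
Proof.
have qT : is_quasi_tree G (val T) := valP T; set S := val T in qT *.
pose N := [set i | active G S i].
have allS (a b : disk_arc G) : same S a b by apply: quasi_tree_same.
have nocross : {in N &, forall f g, f != g ->
    same (toggle S f) (end0 G g) (end1 G g)}.
  move=> f g; rewrite !inE => /(activeP _ qT) af /(activeP _ qT) ag fg.
  have := same_toggle2 G S f g; rewrite !allS.
  case: (ltngtP f g) fg => [fg _|gf _|/val_inj->]; last by rewrite eqxx.
    by rewrite (ag f fg); case: (same _ _ _).
  by rewrite (af g gf).
have ind : indep S [:: p] by [].
have [|z [cz tz qz]] := collapsible_disk ind (mem_head p [::]) _ nocross.
  by move=> f _; rewrite !allS.
have NS : ext_act G S = #|N :\: S|.
  by apply: eq_card => i; rewrite !inE.
have SN : int_act G S = #|N :&: S|.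
  by apply: eq_card => i; rewrite !inE andbC.
have TE := quasi_tree_genus qT.
exists z; split.
- rewrite (_ : cell 0 S = @disk n G p S N [:: p]) //; apply/setP => x.
  rewrite inE; apply/in_cellP/diskP => [Sx | [Sx _] i _ ai].
    split=> [i|a]; last by rewrite allS.
    by rewrite inE; apply: contraR => ai; rewrite Sx.
  by apply/eqP; move: ai; apply: contraNT => /Sx; rewrite inE.
- by apply/in_cellP => i _ ai; rewrite tz !inE (negPf ai) addbF.
- have cS : #|S| = (#|N :&: S| + #|S :\: N|)%N by rewrite setIC cardsID.
  have cz' : #|tag (val z)| = (#|S :\: N| + #|N :\: S|)%N.
    rewrite tz -cardsUI (_ : (S :\: N) :&: (N :\: S) = set0) ?cards0 ?addn0.
      apply: eq_card => i; rewrite !inE.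
      by case: (_ \in S); case: (active _ _ _).
    by apply/setP => i; rewrite !inE; case: (_ \in S); rewrite ?andbF.
  split.
    rewrite /kh_hdeg cz' /qt_hdeg -/S NS SN.
    move: TE cS; move: #|S :\: N| #|N :\: S| #|N :&: S| #|S| #|vertex G|.
    by move: (genus _ _); lia.
  rewrite qz kh_qdeg_word_gen // /qt_qdeg -/S NS SN.
  have -> : nb G S = 1%N by apply/eqP.
  move: TE; move: #|N :\: S| #|N :&: S| #|S| #|vertex G| (genus _ _) => /=.
  lia.
Qed.

Lemma dcoef_add i (x y : rkh_gen p) :
  (i \in tag (val x)) -> (i \notin tag (val y)) -> kh_coef (val x) (val y) = 0.
Proof.
move=> ix iy; apply/eqP; apply: contraNT iy => /kh_coef_neq0[e _ [_ ->]].
by rewrite in_setU1 ix orbT.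
Qed.

(** Gluing the cells in the order in which they unite: the differential only
    adds edges, so it never goes from the cell that contains the released edge
    to the one that does not. *)
Lemma collapsible_cell (z : quasi_tree G -> rkh_gen p) :
  (forall T : quasi_tree G,
     collapsible (C := rCKh p) (cell 0 (val T)) [set z T]) ->
  forall k (T : quasi_tree G), collapsible (C := rCKh p) (cell k (val T))
    [set z T' | T' in [set T' : quasi_tree G | in_cell k (val T) (val T')]].
Proof.
move=> cz; elim=> [|k IHk] T; have qT : is_quasi_tree G (val T) := valP T.
  rewrite (_ : [set T' : quasi_tree G | _] = [set T]) ?imset_set1 //.
  apply/setP => T'; rewrite in_set1 inE; apply/idP/eqP => [TT'|->]; last first.
    exact: in_cell_refl.
  have qT' : is_quasi_tree G (val T') := valP T'.
  by apply/val_inj/esym/(cell_unique qT qT' TT')/in_cell_refl.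
have [/existsP[i /andP[/eqP ik ai]]|noi] :=
    boolP [exists i : 'I_n, (k == i) && ~~ active G (val T) i]; last first.
  have same_cell S : in_cell k.+1 (val T) S = in_cell k (val T) S.
    apply: in_cell_active => // i ki; apply: contraNT noi => ai.
    by apply/existsP; exists i; rewrite ki eqxx.
  have -> : cell k.+1 (val T) = cell k (val T).
    by apply/setP => x; rewrite !inE same_cell.
  have -> // : [set T' : quasi_tree G | in_cell k.+1 (val T) (val T')] =
               [set T' : quasi_tree G | in_cell k (val T) (val T')].
  by apply/setP => T'; rewrite !inE same_cell.
have [S [qS iS above aS]] := inactive_pivot qT ai.
pose T' : quasi_tree G := Sub S qS.
have split S' := in_cell_split S' qT qS ai aS iS above.
rewrite ik in IHk *.
have cellU : cell i.+1 (val T) = cell i (val T) :|: cell i (val T').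
  by apply/setP => x; rewrite !inE; case: (split (tag (val x))).
have critU : [set U : quasi_tree G | in_cell i.+1 (val T) (val U)] =
    [set U : quasi_tree G | in_cell i (val T) (val U)] :|:
    [set U : quasi_tree G | in_cell i (val T') (val U)].
  by apply/setP => U; rewrite !inE; case: (split (val U)).
have iT (x : rkh_gen p) :
    x \in cell i (val T) -> (i \in tag (val x)) = (i \in val T).
  by rewrite inE; case: (split (tag (val x))).
have iT' (x : rkh_gen p) :
    x \in cell i (val T') -> (i \in tag (val x)) = (i \notin val T).
  by rewrite inE; case: (split (tag (val x))).
have dis : [disjoint cell i (val T) & cell i (val T')].
  rewrite -setI_eq0; apply/eqP/setP => x; rewrite in_setI in_set0.
  apply/negbTE/andP => -[xT xT']; have := iT' x xT'.
  by rewrite iT //; case: (_ \in _).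
rewrite cellU critU imsetU; have Cc := rCKh_is_cochain_complex p.
have [iT1|iT0] := boolP (i \in val T).
  rewrite setUC [in X in collapsible _ X]setUC; apply: collapsible_glue => //.
    by rewrite disjoint_sym.
  move=> x y xT yT'; apply: (@dcoef_add i);
    by rewrite ?(iT _ xT) ?(iT' _ yT') ?negbK.
apply: collapsible_glue => // x y xT' yT.
by apply: (@dcoef_add i); rewrite ?(iT' _ xT') ?(iT _ yT).
Qed.

Lemma critical_inj (z : quasi_tree G -> rkh_gen p) :
  (forall T : quasi_tree G, in_cell 0 (val T) (tag (val (z T)))) -> injective z.
Proof.
move=> zT T T' zz; apply: val_inj.
by apply: (@cell_unique (tag (val (z T)))); rewrite ?(valP T) ?(valP T') // zz.
Qed.

End Cells.

(** * The quasi-tree complex *)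

Theorem theorem7p9 (n : nat) (G : ribbon_graph n) (p : disk_arc G)
    (Gconn : connected_graph G) :
  exists A : bigraded,
    [/\ is_cochain_complex A,
        exists phi : gen A -> quasi_tree G,
          bijective phi /\
          (forall x : gen A,
             hdeg x = qt_hdeg (phi x) /\ qdeg x = qt_qdeg (phi x))
      & forall i j : int, isomorphic (cohomology A i j) (rKh p i j)].
Proof.
have [z zP] := fin_all_exists (exists_critical p).
have zc T : collapsible (C := rCKh p) (cell p 0 (val T)) [set z T].
  by case: (zP T).
have z_inj : injective z by apply: critical_inj => T; case: (zP T).
have zdeg T : hdeg (z T : gen (rCKh p)) = qt_hdeg T /\
              qdeg (z T : gen (rCKh p)) = qt_qdeg T by case: (zP T).
have [T0 qT0] := exists_quasi_tree Gconn.
have top S : in_cell G n T0 S.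
  by apply/in_cellP => i; rewrite leqNgt ltn_ord.
have zT : collapsible (C := rCKh p) setT [set z T | T in {: quasi_tree G}].
  have := collapsible_cell zc n (Sub T0 qT0 : quasi_tree G).
  have -> : cell p n T0 = setT by apply/setP => x; rewrite !inE top.
  have -> // : [set z T' | T' in [set T' : quasi_tree G |
        in_cell G n T0 (val T')]] = [set z T | T in {: quasi_tree G}].
  apply/setP => x; apply/imsetP/imsetP => -[T _ ->]; exists T => //.
  by rewrite inE top.
have [coef [Ac iso]] :=
  collapsible_reduction (rCKh_is_cochain_complex p) z_inj zdeg zT.
exists (Bigraded (@qt_hdeg n G) (@qt_qdeg n G) coef); split=> //.
by exists id; split=> //; exists id.
Qed.
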